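(* Let $\Phi_n$ be an irreducible root system of type $A_n$ ($n\ge 1$), $B_n$ ($n\ge 2$), $C_n$ ($n\ge 3$) or $D_n$ ($n\ge 4$), let $q$ be a power of a prime $p$, and assume $p>2$ if $\Phi_n$ is of type $B_n$ or $C_n$. Let $UY_n=UY_n(q)$ be the corresponding maximal unipotent subgroup. For every positive root $\alpha\in\Phi_n^+$, with the arm $a(\alpha)$ chosen as specified in the context (it satisfies conditions (1) and (2) there) and with the associated groups $S_\alpha$ and $\overline{T}_\alpha$, the map $$\Psi:\operatorname{Irr}(\overline{T}_\alpha)\times\operatorname{Irr}(X_\alpha)^*\to\operatorname{Irr}(UY_n)_\alpha,\qquad (\mu,\lambda)\mapsto\bigl(\operatorname{Infl}_{\overline{T}_\alpha}^{S_\alpha}\mu\cdot\operatorname{Infl}_{X_\alpha}^{S_\alpha}\lambda\bigr)^{UY_n}$$ is a one to one correspondence (bijection).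
   Context: Let $q$ be a power of a prime $p$, $\Phi$ an irreducible root system of Dynkin type $Y$ and rank $n$ with set of positive roots $\Phi^+$, $Y_n(q)$ the untwisted Chevalley group over $\mathbb{F}_q$ of this type with root subgroups $X_\gamma=\{x_\gamma(t)\mid t\in\mathbb{F}_q\}$, and $UY_n=UY_n(q)=\langle X_\gamma\mid\gamma\in\Phi^+\rangle$. Write $\beta\preceq\alpha$ if $\alpha-\beta$ is $0$ or a sum of positive roots. A set $S\subseteq\Phi^+$ is a closed pattern if $\beta,\gamma\in S$ and $\beta+\gamma\in\Phi^+$ imply $\beta+\gamma\in S$; then $P(S)=\langle X_\gamma\mid\gamma\in S\rangle$. For $N\subseteq S$ with $S$ a closed pattern, $N\unlhd S$ means: $\beta\in N$, $\gamma\in S$, $\beta+\gamma\in\Phi^+$ imply $\beta+\gamma\in N$; then $N$ is a closed pattern and $P(N)$ is normal in $P(S)$. For $\alpha\in\Phi^+$: $k(\alpha)$ is the largest $N\unlhd\Phi^+$ with $\alpha\notin N$ (equivalently $k(\alpha)=\{\beta\in\Phi^+\mid\beta\not\preceq\alpha\}$). The hook is $h(\alpha)=\{\gamma\in\Phi^+\mid\alpha-\gamma\in\Phi^+\cup\{0\}\}$. An arm $a(\alpha)$ with leg $\ell(\alpha)$ is a pair of subsets such that $h(\alpha)$ is the disjoint union $\{\alpha\}\cup a(\alpha)\cup\ell(\alpha)$, $|a(\alpha)|=|\ell(\alpha)|$, and for each $\beta\in a(\alpha)$ there is a unique $\gamma\in\ell(\alpha)$ with $\beta+\gamma=\alpha$.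 The source is $s(\alpha)=\Phi^+\setminus a(\alpha)$. The conditions are: (1) $s(\alpha)$ is a closed pattern; (2) $\ell(\alpha)\cup k(\alpha)\unlhd s(\alpha)$. When they hold put $S_\alpha=P(s(\alpha))$ and $\overline{T}_\alpha=S_\alpha/P(\{\alpha\}\cup\ell(\alpha)\cup k(\alpha))$. Since $s(\alpha)\setminus\{\alpha\}\unlhd s(\alpha)$, the group $X_\alpha$ is identified with $S_\alpha/P(s(\alpha)\setminus\{\alpha\})$, and $\operatorname{Infl}_{X_\alpha}^{S_\alpha}$ is inflation along this quotient map. $\operatorname{Irr}(G)$ is the set of complex irreducible characters of $G$, $\operatorname{Irr}(G)^*=\operatorname{Irr}(G)\setminus\{\mathbf{1}_G\}$, $\lambda^U$ denotes induction, and $\operatorname{Infl}$ inflation. For $\chi\in\operatorname{Irr}(UY_n)$ put $\operatorname{rs}(\chi)=\{\gamma\in\Phi^+\mid X_\gamma\subseteq Z(\chi),\ X_\gamma\not\subseteq\ker\chi\}$, and $\operatorname{Irr}(UY_n)_\alpha=\{\chi\in\operatorname{Irr}(UY_n)\mid\operatorname{rs}(\chi)=\{\alpha\}\}$. Choice of arms (with orthonormal vectors $e_1,e_2,\dots$). Positive roots: type $A_n$: $e_i-e_j$ ($1\le i<j\le n+1$); $B_n$: $e_i\pm e_j$ ($1\le i<j\le n$) and $e_i$; $C_n$: $e_i\pm e_j$ ($1\le i<j\le n$) and $2e_i$; $D_n$: $e_i\pm e_j$ ($1\le i<j\le n$). In all types, for $\alpha=e_i-e_j$: $a(\alpha)=\{e_i-e_s\mid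 i<s<j\}$. For $\alpha=e_j+e_i$ with $j<i$: type $B_n$: $a(\alpha)=\{e_i\}\cup\{e_i\pm e_s\mid i<s\le n\}\cup\{e_j-e_s\mid j<s<i\}$; type $C_n$: $a(\alpha)=\{2e_i\}\cup\{e_i\pm e_s\mid i<s\le n\}\cup\{e_j-e_s\mid j<s<i\}$; type $D_n$: $a(\alpha)=\{e_i\pm e_s\mid i<s\le n\}\cup\{e_j-e_s\mid j<s<i\}$. For $\alpha=e_j$ in type $B_n$: $a(\alpha)=\{e_s\mid j<s\le n\}$. For $\alpha=2e_j$ in type $C_n$: $a(\alpha)=\{e_j-e_s\mid j<s\le n\}$. *)

(* Defs.v *)
From HB Require Import structures.
From mathcomp Require Import all_boot all_order all_algebra all_fingroup.
From mathcomp Require Import all_solvable all_field all_character.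
From mathcomp Require Import zify ring.

Set Implicit Arguments.
Unset Strict Implicit.
Unset Printing Implicit Defensive.

Import GroupScope GRing.Theory.
Local Open Scope ring_scope.

Variant dynkin := TypeA | TypeB | TypeC | TypeD.

Definition rank_ok (Y : dynkin) (n : nat) : bool :=
  match Y with
  | TypeA => 1 <= n
  | TypeB => 2 <= n
  | TypeC => 3 <= n
  | TypeD => 4 <= n
  end%N.

Definition ambdim (Y : dynkin) (n : nat) : nat :=
  if Y is TypeA then n.+1 else n.

(* Minus i j, Plus i j, Short i and Long i stand for the vectors
   e_i - e_j, e_i + e_j, e_i and 2 e_i; indices start at 0. *)
Variant shape (m : nat) : predArgType :=
  | Minus of 'I_m & 'I_m
  | Plus of 'I_m & 'I_m
  | Short of 'I_m
  | Long of 'I_m.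
Arguments Minus {m}.
Arguments Plus {m}.
Arguments Short {m}.
Arguments Long {m}.

Section ShapeFinite.
Variable m : nat.

Definition shape_encode (c : shape m) :
    ('I_m * 'I_m) + ('I_m * 'I_m) + ('I_m + 'I_m) :=
  match c with
  | Minus i j => inl (inl (i, j))
  | Plus i j => inl (inr (i, j))
  | Short i => inr (inl i)
  | Long i => inr (inr i)
  end.

Definition shape_decode
    (s : ('I_m * 'I_m) + ('I_m * 'I_m) + ('I_m + 'I_m)) : shape m :=
  match s with
  | inl (inl (i, j)) => Minus i j
  | inl (inr (i, j)) => Plus i j
  | inr (inl i) => Short i
  | inr (inr i) => Long i
  end.

Lemma shape_encodeK : cancel shape_encode shape_decode.
Proof. by case. Qed.

HB.instance Definition _ := Finite.copy (shape m) (can_type shape_encodeK).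

End ShapeFinite.

Definition is_posroot (Y : dynkin) (m : nat) (c : shape m) : bool :=
  match c, Y with
  | Minus i j, _ => (i < j)%N
  | Plus i j, (TypeB | TypeC | TypeD) => (i < j)%N
  | Short _, TypeB => true
  | Long _, TypeC => true
  | _, _ => false
  end.

(* The type of positive roots; it plays the role of Phi^+, so that a set of
   positive roots has type {set posroot Y n} and Phi^+ itself is [set: _]. *)
Record posroot (Y : dynkin) (n : nat) : predArgType := PosRoot {
  rshape : shape (ambdim Y n);
  rshapeP : is_posroot Y rshape
}.

HB.instance Definition _ Y n := [isSub for @rshape Y n].
HB.instance Definition _ Y n := [Finite of posroot Y n by <:].

Definition shape_vec (m : nat) (c : shape m) : 'rV[int]_m :=
  let e i : 'rV[int]_m := delta_mx 0 i in
  match c with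
  | Minus i j => e i - e j
  | Plus i j => e i + e j
  | Short i => e i
  | Long i => e i *+ 2
  end.

Definition rvec (Y : dynkin) (n : nat) (g : posroot Y n) :
  'rV[int]_(ambdim Y n) := shape_vec (rshape g).

Section Patterns.
Variables (Y : dynkin) (n : nat).
Local Notation root := (posroot Y n).
Implicit Types (S N a l : {set root}) (alpha beta gamma delta : root).

Definition closed_pattern S : bool :=
  [forall beta in S, forall gamma in S, forall delta : root,
    (rvec delta == rvec beta + rvec gamma) ==> (delta \in S)].

Definition normal_pattern N S : bool :=
  (N \subset S) &&
  [forall beta in N, forall gamma in S, forall delta : root,
    (rvec delta == rvec beta + rvec gamma) ==> (delta \in N)].

(* The union of all normal patterns of Phi^+ avoiding alpha; it is the largest
   one by kset_largest. *)
Definition kset alpha : {set root} :=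
  \bigcup_(N : {set root} | normal_pattern N setT && (alpha \notin N)) N.

Lemma kset_largest alpha :
  [/\ normal_pattern (kset alpha) setT, alpha \notin kset alpha &
      forall N, normal_pattern N setT -> alpha \notin N -> N \subset kset alpha].
Proof.
split; last by move=> N nN aN; apply: bigcup_sup; rewrite nN aN.
- rewrite /normal_pattern subsetT /=.
  apply/forall_inP=> beta /bigcupP[N /andP[nN aN] bN].
  apply/forall_inP=> gamma _; apply/forallP=> delta; apply/implyP=> bgd.
  apply/bigcupP; exists N; first by rewrite nN aN.
  case/andP: nN => _ /forall_inP/(_ _ bN)/forall_inP/(_ gamma (in_setT _)).
  by move=> /forallP/(_ delta)/implyP; apply.
- by apply/bigcupP=> -[N /andP[_ /negP]].
Qed.

Definition hook alpha : {set root} :=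
  [set gamma | (gamma == alpha) ||
     [exists delta : root, rvec delta == rvec alpha - rvec gamma]].

Definition is_arm_leg alpha a l : Prop :=
  [/\ hook alpha = alpha |: (a :|: l),
      alpha \notin a :|: l,
      [disjoint a & l],
      #|a| = #|l|
    & forall beta, beta \in a ->
        exists! gamma, gamma \in l /\ rvec beta + rvec gamma = rvec alpha].

Definition arm_shape (c b : shape (ambdim Y n)) : bool :=
  match c with
  | Minus i j =>
      [exists s : 'I_(ambdim Y n), (i < s < j)%N && (b == Minus i s)]
  | Plus j i =>
      [|| (if Y is TypeB then b == Short i else false),
          (if Y is TypeC then b == Long i else false),
          [exists s : 'I_(ambdim Y n), (i < s)%N && ((b == Minus i s) || (b == Plus i s))]
        | [exists s : 'I_(ambdim Y n), (j < s < i)%N && (b == Minus j s)]]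
  | Short j => [exists s : 'I_(ambdim Y n), (j < s)%N && (b == Short s)]
  | Long j => [exists s : 'I_(ambdim Y n), (j < s)%N && (b == Minus j s)]
  end.

Definition arm alpha : {set root} :=
  [set beta : root | arm_shape (rshape alpha) (rshape beta)].

Definition leg alpha : {set root} := hook alpha :\ alpha :\: arm alpha.

Definition source alpha : {set root} := ~: arm alpha.

End Patterns.

(* The root elements are those of the Chevalley group Y_n(q) in its natural
   representation, inside SL_(n+1), the split SO_(2n+1), Sp_(2n) and the split
   SO_(2n) respectively.  Up to isomorphism the subgroup generated by the positive root
   subgroups does not depend on the representation (isogeny type). *)
Section RootSubgroups.
Variables (Y : dynkin) (n : nat).

(* Dimension of the natural representation, minus one. *)
Definition natdim : nat :=
  match Y with
  | TypeA => n
  | TypeB => n.*2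
  | TypeC | TypeD => n.*2.-1
  end.

(* The weights e_i, 0 and -e_i index the basis of the natural module, in the
   order e_1, ..., e_n, (0,) -e_n, ..., -e_1 for types B, C, D; in type A all
   the weights are e_i. *)
Definition wpos (i : 'I_(ambdim Y n)) : 'I_natdim.+1 := inord i.
Definition wneg (i : 'I_(ambdim Y n)) : 'I_natdim.+1 := rev_ord (wpos i).
Definition wzero : 'I_natdim.+1 := inord n.

Variable F : finFieldType.
Local Notation E := (@delta_mx F natdim.+1 natdim.+1).

(* Root vectors of a Chevalley basis (reduced to F). *)
Definition root_vector (c : shape (ambdim Y n)) : 'M[F]_natdim.+1 :=
  match c with
  | Minus i j =>
      if Y is TypeA then E (wpos i) (wpos j)
      else E (wpos i) (wpos j) - E (wneg j) (wneg i)
  | Plus i j =>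
      if Y is TypeC then E (wpos i) (wneg j) + E (wpos j) (wneg i)
      else E (wpos i) (wneg j) - E (wpos j) (wneg i)
  | Short i => E (wpos i) wzero *+ 2 - E wzero (wneg i)
  | Long i => E (wpos i) (wneg i)
  end.

(* The divided square (root_vector c)^2 / 2!, computed over the integers. *)
Definition root_vector2 (c : shape (ambdim Y n)) : 'M[F]_natdim.+1 :=
  if c is Short i then - E (wpos i) (wneg i) else 0.

(* exp (t * root_vector c); the divided powers of order 3 and more vanish. *)
Definition root_mx (c : shape (ambdim Y n)) (t : F) : 'M[F]_natdim.+1 :=
  1%:M + t *: root_vector c + t ^+ 2 *: root_vector2 c.

End RootSubgroups.

Section RootElements.
Variables (Y : dynkin) (n : nat) (F : finFieldType).
Implicit Types (i j : 'I_(ambdim Y n)) (c : shape (ambdim Y n)).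

Lemma val_wpos i : wpos i = i :> nat.
Proof.
rewrite /wpos inordK //; move: (nat_of_ord i) (ltn_ord i).
by case: Y => /=; rewrite /natdim /ambdim => k; lia.
Qed.

Lemma val_wneg i : wneg i = (natdim Y n - i)%N :> nat.
Proof. by rewrite /= val_wpos subSS. Qed.

Lemma wpos_eq i j : (wpos i == wpos j) = (i == j).
Proof. by rewrite -val_eqE /= !val_wpos. Qed.

Lemma wneg_eq i j : (wneg i == wneg j) = (i == j).
Proof. by rewrite (inj_eq rev_ord_inj) wpos_eq. Qed.

Lemma wneg_neq_wpos i j : ~~ (if Y is TypeA then true else false) -> (wneg i == wpos j) = false.
Proof.
move=> YA; apply/negbTE/eqP=> /(congr1 (@nat_of_ord _)); rewrite val_wneg val_wpos.
move: (nat_of_ord i) (ltn_ord i) (nat_of_ord j) (ltn_ord j) YA.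
by rewrite /natdim /ambdim; case: Y => // k; lia.
Qed.

Lemma wzero_eq i : Y = TypeB ->
  (wpos i == wzero Y n = false) * (wneg i == wzero Y n = false).
Proof.
move=> YB; have z : wzero Y n = n :> nat.
  by rewrite /wzero inordK // YB /= -addnn; lia.
split; apply/negbTE/eqP=> /(congr1 (@nat_of_ord _)); rewrite z ?val_wneg ?val_wpos;
  move: (nat_of_ord i) (ltn_ord i); rewrite YB /= => k; lia.
Qed.

End RootElements.

#[local] Arguments natdim : simpl never.
#[local] Arguments ambdim : simpl never.

Lemma root_vector_exp (Y : dynkin) (n : nat) (F : finFieldType)
    (c : shape (ambdim Y n)) : is_posroot Y c ->
  let e := root_vector F c in let e2 := root_vector2 F c in
  [/\ e *m e = e2 *+ 2, e *m e2 = 0, e2 *m e = 0 & e2 *m e2 = 0].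
Proof.
have := @wneg_neq_wpos Y n.
case: Y c => [] [i j|i j|i|i] //= wnH cP;
  rewrite ?mul0rn ?mul0mx ?mulmx0;
  try (have ij : (i == j) = false by rewrite -val_eqE /= ltn_eqF);
  try (have ji : (j == i) = false by rewrite -val_eqE /= gtn_eqF).
all: rewrite ?mulr2n ?(mulmxDl, mulmxDr, mulmxN, mulNmx) !(mul_delta_mx_cond, wpos_eq, wneg_eq).
by rewrite ji.
all: have wn k l := wnH k l isT;
  have pn k l : (_ == _) = false := etrans (eq_sym _ _) (wn l k).
all: rewrite ?wn ?pn ?ij ?ji ?(mulr0n, addr0, oppr0, subr0, add0r) //.
have z k := @wzero_eq _ n k erefl.
have z' k : (wzero TypeB n == wpos k) = false by rewrite eq_sym z.
have z'' k : (wzero TypeB n == wneg k) = false by rewrite eq_sym z.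
rewrite !(wn, pn, z, z', z'', eqxx).
by rewrite !(mulr0n, mulr1n, addr0, oppr0, subr0, add0r).
Qed.

Lemma root_mxD (Y : dynkin) (n : nat) (F : finFieldType)
    (c : shape (ambdim Y n)) (t u : F) : is_posroot Y c ->
  root_mx c (t + u) = root_mx c t *m root_mx c u.
Proof.
move=> /root_vector_exp-/(_ F)[]; rewrite /root_mx.
move: (root_vector F c) (root_vector2 F c) => e e2 ee ee2 e2e e22.
rewrite !(mulmxDl, mulmxDr) !mul1mx !mulmx1 -!scalemxAl -!scalemxAr.
rewrite ee ee2 e2e e22 !scaler0 !addr0 sqrrD.
apply/matrixP=> x y; rewrite !mxE; move: ((x == y)%:R : F) (e x y) (e2 x y) => a b d.
by ring.
Qed.

Lemma root_mx_unit (Y : dynkin) (n : nat) (F : finFieldType)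
    (c : shape (ambdim Y n)) (t : F) : is_posroot Y c -> root_mx c t \in unitmx.
Proof.
move=> cP; have /mulmx1_unit[] // : root_mx c t *m root_mx c (- t) = 1%:M.
by rewrite -root_mxD // subrr /root_mx expr2 mul0r !scale0r !addr0.
Qed.

Section RootGroups.
Variables (F : finFieldType) (Y : dynkin) (n : nat).
Local Notation root := (posroot Y n).
Local Notation gT := {'GL_(natdim Y n).+1[F]}.
Implicit Types (alpha gamma : root) (S : {set root}).

Definition root_elt gamma (t : F) : gT :=
  FinRing.Unit (root_mx_unit t (rshapeP gamma)).

Definition root_set gamma : {set gT} := [set root_elt gamma t | t : F].

Lemma root_set_group gamma : group_set (root_set gamma).
Proof.
apply/group_setP; split.
  apply/imsetP; exists 0 => //; apply: val_inj.
  by rewrite /= /root_mx expr2 mul0r !scale0r !addr0.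
move=> x y /imsetP[t _ ->] /imsetP[u _ ->]; apply/imsetP; exists (t + u) => //.
by apply: val_inj; rewrite /= root_mxD ?rshapeP.
Qed.

Canonical root_subgroup gamma : {group gT} := Group (root_set_group gamma).

Definition pattern_group S : {group gT} :=
  <<\bigcup_(gamma in S) root_subgroup gamma>>%G.

Definition UY : {group gT} := pattern_group [set: root].

Definition root_support (chi : 'CF(UY)) : {set root} :=
  [set gamma | (root_subgroup gamma \subset 'Z(chi)%CF) &&
               ~~ (root_subgroup gamma \subset cfker chi)].

Definition irr_root alpha : {pred 'CF(UY)} :=
  [pred chi | (chi \in irr UY) && (root_support chi == [set alpha])].

Definition Sgroup alpha : {group gT} := pattern_group (source alpha).

Definition Tkernel alpha : {group gT} :=
  pattern_group (alpha |: leg alpha :|: kset alpha).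

Local Notation T alpha := (Sgroup alpha / Tkernel alpha)%G.

Definition Skernel alpha : {group gT} := pattern_group (source alpha :\ alpha).

(* Inflation along Sgroup alpha -> Sgroup alpha / Skernel alpha, the quotient
   being identified with root_subgroup alpha: this is what cfSdprod does for the
   decomposition Sgroup alpha = Skernel alpha ><| root_subgroup alpha.  The value
   0 is a placeholder for the case where that decomposition fails. *)
Definition infl_root alpha (lambda : 'CF(root_subgroup alpha)) :
    'CF(Sgroup alpha) :=
  match @eqP {set gT} (Skernel alpha ><| root_subgroup alpha)%g (Sgroup alpha) with
  | ReflectT sdS => cfSdprod sdS lambda
  | ReflectF _ => 0
  end.

Definition irr_domain alpha :
    {pred 'CF(T alpha) * 'CF(root_subgroup alpha)} :=
  [pred ml | [&& ml.1 \in irr (T alpha),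
                 ml.2 \in irr (root_subgroup alpha) & ml.2 != 1]].

Definition Psi alpha (ml : 'CF(T alpha) * 'CF(root_subgroup alpha)) : 'CF(UY) :=
  'Ind[UY] ((ml.1 %% Tkernel alpha)%CF * infl_root ml.2).

End RootGroups.

(* f restricts to a bijection from A onto B. *)
Definition bijection_on (aT rT : eqType) (A : {pred aT}) (B : {pred rT})
    (f : aT -> rT) : Prop :=
  [/\ {homo f : x / x \in A >-> x \in B},
      {in A &, injective f}
    & forall y, y \in B -> exists2 x, x \in A & f x = y].

(* Main.v *)
Require Import Defs.
From HB Require Import structures.
From mathcomp Require Import all_boot all_order all_algebra all_fingroup.
From mathcomp Require Import all_solvable all_field all_character.
From mathcomp Require Import zify ring.

Set Implicit Arguments.
Unset Strict Implicit.
Unset Printing Implicit Defensive.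

Import GroupScope GRing.Theory.
(* The constructors and names of the root system take precedence over their
   namesakes on sequences. *)
Import Defs.

(** Fix the root alpha; write k, a, l for its set k(alpha), arm and leg, P(N)
    for the pattern group of N and U for the full group P(Phi+).

    An irreducible character chi of U has root support {alpha} exactly when
    P(k) lies in its kernel and X_alpha does not ([irr_rootP]).  Indeed a root
    of k of maximal height outside the kernel would be central, hence in the
    root support; and if some gamma <> alpha outside k were central, one could
    climb from gamma to alpha by adding positive roots, and iterated
    commutators would put X_alpha into the kernel.

    So everything happens modulo P(k), where X_alpha is central.  The set
    H = {alpha} + l + k is normal in Phi+ ([hookk_normal]).  Let lambda <> 1 be
    a character of X_alpha and phi its extension to P(H) that is trivial on
    P(l + k).  Commutation pairs the arm with the leg: if beta + gamma = alpha
    then [x_gamma(v), x_beta(t)] is x_alpha(c v t) modulo P(k), with c <> 0.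
    This pairing is triangular for the height, so no element of U outside
    S = P(source) fixes phi, and S itself does: the inertia group of phi is S
    ([inertia_source]).  The orbit of phi thus has |U : S| = q^|a| elements;
    as q^|a| = q^|l| is also the index of P(k) X_alpha in P(H), this orbit is
    everything in Irr(P(H)) that lies above lambda and is trivial on P(k)
    ([Ind_Res_sum_cfclass]).  Clifford's correspondence therefore says that
    induction is a bijection from Irr(S | phi) to the characters of U that lie
    above lambda and are trivial on P(k).  Finally lambda inflates to a linear
    character theta of S extending phi, and mu |-> Infl(mu) theta is a
    bijection from Irr(S / P(H)) to Irr(S | phi) ([arm_leg_correspondence]).

    The argument needs three facts about the root subgroups, gathered in
    [root_system_group]: commutators of root elements lie in the expected root
    subgroups; their leading coefficient c is nonzero when the sum is a root,
    which is where p > 2 enters in types B and C; and the root subgroups are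
    independent, so that |P(N)| = q^|N| for closed N.  The first two are matrix
    computations for each kind of sum of two positive roots ([root_comm_sum],
    [root_comm_nosum]).  The third follows from a grading of the natural module
    ([root_elt_indep]).  The combinatorial facts on arms and legs come from a
    classification of the sums of two positive roots ([sum_shapeP]), after which
    they are linear arithmetic on indices. *)

Ltac mx_ring := apply/matrixP=> ? ?; rewrite !mxE; ring.

Local Notation notA Y := (~~ (if Y is TypeA then true else false)).

(** * Sums of two positive roots *)

Section RootSums.
Local Open Scope ring_scope.

Definition plus_idx m (c : shape m) : seq 'I_m :=
  match c with
  | Minus i _ => [:: i]
  | Plus i j => [:: i; j]
  | Short i => [:: i]
  | Long i => [:: i; i]
  end.

Definition minus_idx m (c : shape m) : seq 'I_m :=
  if c is Minus _ j then [:: j] else [::].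

Lemma shape_vecE m (c : shape m) x :
  shape_vec c 0 x
    = (count_mem x (plus_idx c))%:Z - (count_mem x (minus_idx c))%:Z.
Proof.
case: c => [i j|i j|i|i] /=; rewrite ?mulr2n !mxE !eqxx /= !(eq_sym x).
- by case: (i == x); case: (j == x).
- by case: (i == x); case: (j == x).
- by case: (i == x).
- by case: (i == x).
Qed.

(** An equation between root vectors, with the negative terms moved to the other
    side, is an equality of multisets of at most three indices: it can be solved
    by enumerating permutations. *)
Lemma shape_vec_perm m (a b c : shape m) :
  (shape_vec c == shape_vec a + shape_vec b) =
  perm_eq (plus_idx c ++ minus_idx a ++ minus_idx b)
          (minus_idx c ++ plus_idx a ++ plus_idx b).
Proof.
apply/eqP/idP => [/rowP E | /seq.permP E].
  apply/allP=> x _; rewrite !inE /= !count_cat.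
  move: (E x); rewrite mxE !shape_vecE.
  move: (count_mem x (plus_idx a)) (count_mem x (plus_idx b))
    (count_mem x (plus_idx c)) (count_mem x (minus_idx a))
    (count_mem x (minus_idx b)) (count_mem x (minus_idx c)) => u v w u' v' w' E'.
  by apply/eqP; lia.
apply/rowP=> x; move: (E (pred1 x)); rewrite !count_cat mxE !shape_vecE.
move: (count_mem x (plus_idx a)) (count_mem x (plus_idx b))
  (count_mem x (plus_idx c)) (count_mem x (minus_idx a))
  (count_mem x (minus_idx b)) (count_mem x (minus_idx c)) => u v w u' v' w'.
lia.
Qed.

Lemma perm_eq1 (T : eqType) (a x : T) : perm_eq [:: a] [:: x] -> a = x.
Proof. by move/perm_mem/(_ a); rewrite !inE eqxx => /esym/eqP. Qed.

Lemma perm_eq2 (T : eqType) (a b x y : T) : perm_eq [:: a; b] [:: x; y] ->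
  a = x /\ b = y \/ a = y /\ b = x.
Proof.
move=> E; have : a \in [:: x; y] by rewrite -(perm_mem E) mem_head.
rewrite !inE => /orP[]/eqP ea; subst a; [left | right]; split=> //.
  by apply: perm_eq1; rewrite -(perm_cons x).
by apply: perm_eq1; rewrite -(perm_cons y) (perm_trans E) // (perm_catC [:: x]).
Qed.

Lemma perm_eq3 (T : eqType) (a b c x y z : T) :
  perm_eq [:: a; b; c] [:: x; y; z] ->
  [\/ a = x /\ (b = y /\ c = z \/ b = z /\ c = y),
      a = y /\ (b = x /\ c = z \/ b = z /\ c = x)
    | a = z /\ (b = x /\ c = y \/ b = y /\ c = x)].
Proof.
move=> E; have : a \in [:: x; y; z] by rewrite -(perm_mem E) mem_head.
rewrite !inE => /or3P[]/eqP ea; subst a; [apply: Or31 | apply: Or32 | apply: Or33];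
  split=> //; apply: perm_eq2.
- by rewrite -(perm_cons x).
- by rewrite -(perm_cons y) (perm_trans E) // (perm_catCA [:: x] [:: y]).
- by rewrite -(perm_cons z) (perm_trans E) // (perm_catC [:: x; y]).
Qed.

Ltac case_perm E :=
  match type of E with
  | is_true (perm_eq [:: _] [:: _]) => move/perm_eq1: E => ?
  | is_true (perm_eq [:: _; _] [:: _; _]) => case/perm_eq2: E => -[? ?]
  | is_true (perm_eq [:: _; _; _] [:: _; _; _]) =>
      case/perm_eq3: E => -[? []] [? ?]
  end.

Lemma shape_vec_inj Y m (a b : shape m) :
  is_posroot Y a -> is_posroot Y b -> shape_vec a = shape_vec b -> a = b.
Proof.
move=> aP bP ab.
have E : perm_eq (plus_idx a ++ minus_idx b) (minus_idx a ++ plus_idx b).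
  apply/allP=> x _; rewrite !inE /= !count_cat.
  move/rowP: ab => /(_ x); rewrite !shape_vecE.
  move: (count_mem x (plus_idx a)) (count_mem x (plus_idx b))
  (count_mem x (minus_idx a)) (count_mem x (minus_idx b)) => u v u' v' E'.
  by apply/eqP; lia.
case: a b Y aP bP E {ab} => [i j|i j|i|i] [k l|k l|k|k] [] //= aP bP E;
  move: (perm_size E) => //= _; move: aP bP.
all: case_perm E; subst=> //; rewrite ?ltnn // => u1 u2.
all: move: (ltn_trans u1 u2); rewrite ltnn => //.
Qed.

(** All ways in which two positive roots add up to a third, up to exchanging the
    summands.  A root e_i + e_j is stored with i < j, whence the three
    constructors for (e_i - e_j) + (e_j + e_k), according to the rank of k. *)
Variant sum_shape m : shape m -> shape m -> shape m -> Prop :=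
  | SumMM i j k : sum_shape (Minus i j) (Minus j k) (Minus i k)
  | SumMPjkik i j k : sum_shape (Minus i j) (Plus j k) (Plus i k)
  | SumMPkjik i j k : sum_shape (Minus i j) (Plus k j) (Plus i k)
  | SumMPkjki i j k : sum_shape (Minus i j) (Plus k j) (Plus k i)
  | SumMP i j : sum_shape (Minus i j) (Plus i j) (Long i)
  | SumMS i j : sum_shape (Minus i j) (Short j) (Short i)
  | SumML i j : sum_shape (Minus i j) (Long j) (Plus i j)
  | SumSS i j : sum_shape (Short i) (Short j) (Plus i j).

Lemma sum_shapeP Y m (a b c : shape m) :
    is_posroot Y a -> is_posroot Y b -> is_posroot Y c ->
    shape_vec c = shape_vec a + shape_vec b ->
  sum_shape a b c \/ sum_shape b a c.
Proof.
move=> aP bP cP /eqP; rewrite shape_vec_perm => E.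
case: a b c Y aP bP cP E => [i j|i j|i|i] [k l|k l|k|k] [u v|u v|u|u] [] //= aP bP cP;
  move=> E; move: (perm_size E) => // _.
all: case_perm E; subst; try (by left; constructor); try (by right; constructor).
(* the remaining matchings of indices contradict their order *)
all: exfalso; lia.
Qed.
End RootSums.

(** * Heights, arms and legs in terms of indices *)

(** The value of the root on the coweight e_i |-> m - i.  It is not the usual
    height, but it is additive and positive on positive roots. *)
Definition ht_shape m (c : shape m) : nat :=
  match c with
  | Minus i j => j - i
  | Plus i j => (m - i) + (m - j)
  | Short i => m - i
  | Long i => (m - i).*2
  end.

(** The sum of the coordinates of the root in positions 0, ..., x.  It is
    nonnegative on positive roots, so it can only grow when positive roots are
    added. *)
Definition psum m (c : shape m) (x : nat) : nat :=
  match c with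
  | Minus i j => (i <= x < j)%N
  | Plus i j => (i <= x)%N + (j <= x)%N
  | Short i => (i <= x)%N
  | Long i => (i <= x)%N.*2
  end.

(** The arm and the leg as quantifier-free conditions on the indices, viewed as
    natural numbers, so that statements about them fall within linear
    arithmetic. *)
Definition arm_idx m (a b : shape m) : bool :=
  match a, b with
  | Minus i j, Minus x s => (x == i :> nat) && (i < s < j)%N
  | Plus j i, Short s => (s == i :> nat)
  | Plus j i, Long s => (s == i :> nat)
  | Plus j i, Minus x s =>
      ((x == i :> nat) && (i < s)%N) || ((x == j :> nat) && (j < s < i)%N)
  | Plus j i, Plus x s => (x == i :> nat) && (i < s)%N
  | Short j, Short s => (j < s)%N
  | Long j, Minus x s => (x == j :> nat) && (j < s)%N
  | _, _ => false
  end.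

Definition leg_idx Y m (a b : shape m) : bool :=
  match a, b with
  | Minus i j, Minus s y => (y == j :> nat) && (i < s < j)%N
  | Plus j i, Minus x s =>
      (x == j :> nat) && ((i < s)%N || (if Y is TypeC then s == i :> nat else false))
  | Plus j i, Plus x y =>
      (x == j :> nat) && (i < y)%N || (y == i :> nat) && (j < x < i)%N
  | Plus j i, Short s => (s == j :> nat)
  | Short j, Minus x s => (x == j :> nat) && (j < s)%N
  | Long j, Plus x s => (x == j :> nat) && (j < s)%N
  | _, _ => false
  end.

Definition eq_idx m (a b : shape m) : bool :=
  match a, b with
  | Minus i j, Minus x y => (i == x :> nat) && (j == y :> nat)
  | Plus i j, Plus x y => (i == x :> nat) && (j == y :> nat)
  | Short i, Short x => (i == x :> nat)
  | Long i, Long x => (i == x :> nat)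
  | _, _ => false
  end.

Lemma eq_idxP m (a b : shape m) : eq_idx a b -> a = b.
Proof.
case: a b => [i j|i j|i|i] [k l|k l|k|k] //=.
- by case/andP=> /eqP/val_inj-> /eqP/val_inj->.
- by case/andP=> /eqP/val_inj-> /eqP/val_inj->.
- by move=> /eqP/val_inj->.
- by move=> /eqP/val_inj->.
Qed.

Lemma ht_shape_gt0 Y m (c : shape m) : is_posroot Y c -> (0 < ht_shape c)%N.
Proof. by case: c => [i j|i j|i|i] /=; have := ltn_ord i; lia. Qed.

Lemma ht_shapeD Y m (a b c : shape m) :
    is_posroot Y a -> is_posroot Y b -> is_posroot Y c -> sum_shape a b c ->
  ht_shape c = (ht_shape a + ht_shape b)%N.
Proof.
move=> aP bP cP s; case: s aP bP cP => [i j k|i j k|i j k|i j k|i j|i j|i j|i j] /=;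
  have := ltn_ord i; have := ltn_ord j; try (have := ltn_ord k); case: Y => //= *; lia.
Qed.

Lemma psumD Y m (a b c : shape m) x :
    is_posroot Y a -> is_posroot Y b -> is_posroot Y c -> sum_shape a b c ->
  psum c x = (psum a x + psum b x)%N.
Proof.
move=> aP bP cP s; case: s aP bP cP => [i j k|i j k|i j k|i j k|i j|i j|i j|i j] /=;
  case: Y => //= *; lia.
Qed.

(** This makes the leg the set of partners of the arm; like the two lemmas that
    follow, it is checked on each kind of sum. *)
Lemma arm_leg_split Y m (a b c : shape m) :
    is_posroot Y a -> is_posroot Y b -> is_posroot Y c -> sum_shape a b c ->
  arm_idx c a && leg_idx Y c b && ~~ arm_idx c b
  || arm_idx c b && leg_idx Y c a && ~~ arm_idx c a.
Proof.
move=> aP bP cP s; case: s aP bP cP => [i j k|i j k|i j k|i j k|i j|i j|i j|i j] /=;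
  have := ltn_ord i; have := ltn_ord j; case: Y => //= *; lia.
Qed.

Lemma arm_idx_sum Y m (a b c d : shape m) : is_posroot Y d ->
    is_posroot Y a -> is_posroot Y b -> is_posroot Y c -> sum_shape a b c ->
  arm_idx d c -> arm_idx d a || arm_idx d b.
Proof.
move=> dP aP bP cP s; case: s aP bP cP => [i j k|i j k|i j k|i j k|i j|i j|i j|i j] /=;
  case: d dP => [u v|u v|u|u] /=; case: Y => //= *; lia.
Qed.

(** The combinatorial heart: adding a positive root to a leg root of d gives d, a
    leg root of d, or a root with a partial sum exceeding that of d; the last
    kind belongs to k(d). *)
Lemma leg_idx_sum Y m (a b c d : shape m) : is_posroot Y d ->
    is_posroot Y a -> is_posroot Y b -> is_posroot Y c -> sum_shape a b c ->
  leg_idx Y d a || leg_idx Y d b -> (forall x : 'I_m, psum c x <= psum d x)%N ->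
  eq_idx c d || leg_idx Y d c.
Proof.
move=> dP aP bP cP s; case: s aP bP cP => [i j k|i j k|i j k|i j k|i j|i j|i j|i j] /=;
  case: d dP => [u v|u v|u|u] /=; case: Y => //= dP aP bP cP L D;
  try (have := D u); try (have := D v); have := D i; try (have := D j);
  try (have := D k); move: L => {D}.
all: lia.
Qed.

Lemma leg_arm_idx Y m (a b : shape m) : is_posroot Y a -> is_posroot Y b ->
  arm_idx a b -> ~~ leg_idx Y a b.
Proof.
case: a b => [i j|i j|i|i] [k l|k l|k|k] //=; case: Y => //= *; lia.
Qed.

Lemma posroot_Plus Y m (i j k l : 'I_m) :
  is_posroot Y (Plus i j) -> (k < l)%N -> is_posroot Y (Plus k l).
Proof. by case: Y. Qed.

Lemma Plus_lt Y m (i j : 'I_m) : is_posroot Y (Plus i j) -> (i < j)%N.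
Proof. by case: Y. Qed.

Lemma Long_Plus Y m (i k l : 'I_m) :
  is_posroot Y (Long i) -> (k < l)%N -> is_posroot Y (Plus k l).
Proof. by case: Y. Qed.

(** * Patterns, the arm, the leg and the set k(alpha) *)

Section Roots.
Local Open Scope ring_scope.
Variables (Y : dynkin) (n : nat).
Local Notation root := (posroot Y n).
Implicit Types (S N : {set root}) (alpha beta gamma delta : root).

Definition rsum beta gamma delta := rvec delta == rvec beta + rvec gamma.

Lemma rsumC beta gamma delta : rsum beta gamma delta = rsum gamma beta delta.
Proof. by rewrite /rsum addrC. Qed.

Lemma rvec_inj : injective (@rvec Y n).
Proof.
by move=> b c bc; apply: val_inj; apply: (shape_vec_inj (rshapeP b) (rshapeP c)).
Qed.

Lemma rsum_shape beta gamma delta : rsum beta gamma delta ->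
  sum_shape (rshape beta) (rshape gamma) (rshape delta) \/
  sum_shape (rshape gamma) (rshape beta) (rshape delta).
Proof. by move=> /eqP; apply: sum_shapeP; apply: rshapeP. Qed.

Definition ht gamma := ht_shape (rshape gamma).

Lemma ht_gt0 gamma : (0 < ht gamma)%N.
Proof. exact: ht_shape_gt0 (rshapeP gamma). Qed.

Lemma htD beta gamma delta : rsum beta gamma delta ->
  ht delta = (ht beta + ht gamma)%N.
Proof.
case/rsum_shape=> /ht_shapeD E; rewrite /ht (E Y) ?rshapeP //.
by rewrite addnC.
Qed.

Lemma closed_patternP S : reflect
  (forall beta gamma delta, beta \in S -> gamma \in S -> rsum beta gamma delta ->
     delta \in S) (closed_pattern S).
Proof.
apply: (iffP forall_inP) => [H beta gamma delta bS gS | H beta bS].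
  by move/forall_inP: (H _ bS) => /(_ _ gS)/forallP/(_ delta)/implyP.
by apply/forall_inP=> gamma gS; apply/forallP=> delta; apply/implyP; apply: H.
Qed.

Lemma normal_patternP N S : reflect
  (N \subset S /\
   forall beta gamma delta, beta \in N -> gamma \in S -> rsum beta gamma delta ->
     delta \in N) (normal_pattern N S).
Proof.
apply: (iffP andP) => -[NS H]; split=> //.
  move=> beta gamma delta bN gS.
  by move/forall_inP: H => /(_ _ bN)/forall_inP/(_ _ gS)/forallP/(_ delta)/implyP.
apply/forall_inP=> beta bN; apply/forall_inP=> gamma gS.
by apply/forallP=> delta; apply/implyP; apply: H bN gS.
Qed.

Lemma in_arm alpha beta : (beta \in arm alpha) = arm_idx (rshape alpha) (rshape beta).
Proof.
rewrite inE; move: (rshapeP alpha) (rshapeP beta).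
move: (rshape alpha) (rshape beta) => a b aP bP; apply/idP/idP.
  case: a aP => [i j|j i|j|j] aP /=.
  - by case/existsP=> s /andP[ijs /eqP->] /=; rewrite eqxx.
  - case/or4P.
    + have dB (x : bool) : (if Y is TypeB then x else false) -> x by case: Y.
      by move/dB/eqP=> -> /=.
    + have dC (x : bool) : (if Y is TypeC then x else false) -> x by case: Y.
      by move/dC/eqP=> -> /=.
    + by case/existsP=> s /andP[ijs /orP[]/eqP->] /=; rewrite eqxx ijs.
    + by case/existsP=> s /andP[ijs /eqP->] /=; rewrite eqxx ijs orbT.
  - by case/existsP=> s /andP[ijs /eqP->] /=.
  - by case/existsP=> s /andP[ijs /eqP->] /=; rewrite eqxx.
case: a b aP bP => [i j|j i|j|j] [k l|k l|k|k] //= aP bP.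
- by case/andP=> /eqP/val_inj-> ijl; apply/existsP; exists l; rewrite ijl eqxx.
- case/orP=> /andP[/eqP/val_inj-> lt].
    by apply/or4P/Or43/existsP; exists l; rewrite lt eqxx.
  by apply/or4P/Or44/existsP; exists l; rewrite lt eqxx.
- case/andP=> /eqP/val_inj-> lt.
  by apply/or4P/Or43/existsP; exists l; rewrite lt eqxx.
- by move=> /eqP/val_inj->; apply/or4P/Or41; rewrite eqxx; case: Y bP.
- by move=> /eqP/val_inj->; apply/or4P/Or42; rewrite eqxx; case: Y bP.
- by move=> jk; apply/existsP; exists k; rewrite jk eqxx.
- by case/andP=> /eqP/val_inj-> lt; apply/existsP; exists l; rewrite lt eqxx.
Qed.

Lemma arm_hook alpha beta : beta \in arm alpha -> exists gamma, rsum beta gamma alpha.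
Proof.
rewrite in_arm; case: alpha beta => a aP [b bP] /=.
have R c (cP : is_posroot Y c) : shape_vec a = shape_vec b + shape_vec c ->
    exists gamma, rsum (PosRoot bP) gamma (PosRoot aP).
  by move=> E; exists (PosRoot cP); apply/eqP.
case: a b aP bP R => [i j|j i|j|j] [k l|k l|k|k] //= aP bP R.
- case/andP=> /eqP/val_inj ? /andP[? lt]; subst k.
  by apply: (R (Minus l j)) => //=; mx_ring.
- case/orP=> /andP[/eqP/val_inj ? lt]; subst k.
    apply: (R (Plus j l)) => /=; last by mx_ring.
    exact: (posroot_Plus aP (ltn_trans (Plus_lt aP) lt)).
  case/andP: lt => _ lt; apply: (R (Plus l i)) => /=; last by mx_ring.
  exact: (posroot_Plus aP lt).
- case/andP=> /eqP/val_inj ? lt; subst k.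
  apply: (R (Minus j l)) => /=; last by mx_ring.
  exact: (ltn_trans (Plus_lt aP) lt).
- by move=> /eqP/val_inj ?; subst k; apply: (R (Short j)) => //=; mx_ring.
- move=> /eqP/val_inj ?; subst k; apply: (R (Minus j i)) => /=; last by mx_ring.
  exact: (Plus_lt aP).
- by move=> jk; apply: (R (Minus j k)) => //=; mx_ring.
- case/andP=> /eqP/val_inj ? lt; subst k.
  by apply: (R (Plus j l)) => /=; [exact: (Long_Plus aP lt) | mx_ring].
Qed.

Lemma leg_idx_hook alpha gamma : leg_idx Y (rshape alpha) (rshape gamma) ->
  exists beta, rsum beta gamma alpha.
Proof.
case: alpha gamma => a aP [b bP] /=.
have R c (cP : is_posroot Y c) : shape_vec a = shape_vec c + shape_vec b ->
    exists beta, rsum beta (PosRoot bP) (PosRoot aP).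
  by move=> E; exists (PosRoot cP); apply/eqP.
case: a b aP bP R => [i j|j i|j|j] [k l|k l|k|k] //= aP bP R.
- case/andP=> /eqP/val_inj ? /andP[lt _]; subst l.
  by apply: (R (Minus i k)) => //=; mx_ring.
- case/andP=> /eqP/val_inj ? /orP[lt|]; subst k.
    by apply: (R (Plus i l)) => /=; [exact: (posroot_Plus aP lt) | mx_ring].
  have dC (x : bool) : (if Y is TypeC then x else false) -> Y = TypeC /\ x by case: Y.
  case/dC=> EY /eqP/val_inj ?; subst l.
  apply: (R (Long i)) => /=; last by mx_ring.
  by clear -EY; case: Y EY.
- case/orP=> /andP[/eqP/val_inj ? lt].
    by subst k; apply: (R (Minus i l)) => //=; mx_ring.
  by subst l; case/andP: lt => lt _; apply: (R (Minus j k)) => //=; mx_ring.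
- by move=> /eqP/val_inj ?; subst k; apply: (R (Short i)) => //=; mx_ring.
- case/andP=> /eqP/val_inj ? lt; subst k.
  by apply: (R (Short l)) => //=; mx_ring.
- case/andP=> /eqP/val_inj ? lt; subst k.
  by apply: (R (Minus j l)) => //=; mx_ring.
Qed.

Lemma rsum_neq beta gamma delta : rsum beta gamma delta ->
  (gamma != delta) && (beta != delta).
Proof.
move/htD=> E; apply/andP; split; apply: contraTneq (leqnn (ht delta)) => D;
  by move: E (ht_gt0 beta) (ht_gt0 gamma); rewrite -D; lia.
Qed.

Lemma arm_leg_rsum alpha beta gamma : rsum beta gamma alpha ->
  [&& beta \in arm alpha, gamma \notin arm alpha &
      leg_idx Y (rshape alpha) (rshape gamma)] ||
  [&& gamma \in arm alpha, beta \notin arm alpha &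
      leg_idx Y (rshape alpha) (rshape beta)].
Proof.
have A b c : sum_shape (rshape b) (rshape c) (rshape alpha) ->
    [&& b \in arm alpha, c \notin arm alpha & leg_idx Y (rshape alpha) (rshape c)] ||
    [&& c \in arm alpha, b \notin arm alpha & leg_idx Y (rshape alpha) (rshape b)].
  move/(arm_leg_split (rshapeP b) (rshapeP c) (rshapeP alpha)).
  by rewrite !in_arm -!andbA !(andbC (~~ _)).
by case/rsum_shape=> /A; rewrite // orbC.
Qed.

Lemma in_leg alpha gamma :
  (gamma \in leg alpha) = leg_idx Y (rshape alpha) (rshape gamma).
Proof.
apply/idP/idP.
  rewrite !in_setD in_set1 => /and3P[garm /negbTE ga].
  rewrite inE ga => /existsP[b E].
  have /arm_leg_rsum : rsum b gamma alpha.
    by rewrite /rsum (eqP E) subrK.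
  by case/orP=> /and3P[] // gA; case/negP: garm.
move=> L; have [b bga] := leg_idx_hook L; rewrite !in_setD in_set1.
have /andP[/negbTE ga _] := rsum_neq bga; rewrite ga andbC.
rewrite inE ga /=.
apply/andP; split; first by apply/existsP; exists b; rewrite (eqP bga) addrK.
case/orP: (arm_leg_rsum bga) => /and3P[] // garm barm _.
rewrite in_arm in garm.
by have := leg_arm_idx (rshapeP alpha) (rshapeP gamma) garm; rewrite L.
Qed.

Lemma legP alpha gamma :
  reflect (exists2 beta, beta \in arm alpha & rsum beta gamma alpha)
    (gamma \in leg alpha).
Proof.
rewrite in_leg; apply: (iffP idP) => [L | [b barm /arm_leg_rsum]].
  have [b bga] := leg_idx_hook L; exists b => //.
  case/orP: (arm_leg_rsum bga) => /and3P[] // garm barm _.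
  rewrite in_arm in garm.
  by have := leg_arm_idx (rshapeP alpha) (rshapeP gamma) garm; rewrite L.
by rewrite barm /= andbF orbF => /andP[].
Qed.

Lemma leg_notin_arm alpha gamma : gamma \in leg alpha -> gamma \notin arm alpha.
Proof. by rewrite in_setD => /andP[]. Qed.

(** The leg is the image of the arm under beta |-> alpha - beta. *)
Lemma arm_is_arm_leg alpha : is_arm_leg alpha (arm alpha) (leg alpha).
Proof.
have h b : exists g, (b \in arm alpha) ==> rsum b g alpha.
  case: (boolP (b \in arm alpha)) => [/arm_hook[g bg] | _]; first by exists g.
  by exists b.
pose f b := xchoose (h b).
have fP b : b \in arm alpha -> rsum b (f b) alpha.
  by move=> bA; move/implyP: (xchooseP (h b)); apply.
have f_inj : {in arm alpha &, injective f}.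
  move=> b c /fP bA /fP cA E; apply: rvec_inj.
  by move: bA cA; rewrite /rsum E => /eqP-> /eqP/addIr.
have f_im : leg alpha = [set f b | b in arm alpha].
  apply/setP=> g; apply/legP/imsetP=> [[b bA bg] | [b bA ->]]; last first.
    by exists b => //; apply: fP.
  exists b => //; apply: rvec_inj; have := fP b bA.
  by rewrite /rsum (eqP bg) => /eqP/addrI.
split.
- apply/setP=> g; rewrite in_setU1 in_setU !in_setD in_set1.
  case: eqP => [-> | _] /=; first by rewrite inE eqxx.
  have [gA | //] := boolP (g \in arm alpha); rewrite inE.
  have [c bc] := arm_hook gA; apply/orP; right; apply/existsP; exists c.
  by rewrite (eqP bc) addrC addKr.
- rewrite in_setU negb_or; apply/andP; split.
    by apply/negP=> /arm_hook[c /rsum_neq]; rewrite eqxx andbF.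
  by rewrite !in_setD in_set1 eqxx andbF.
- rewrite disjoint_sym disjoints_subset; apply/subsetP=> g /leg_notin_arm.
  by rewrite in_setC.
- by rewrite f_im card_in_imset.
move=> b bA; exists (f b); split; first by rewrite f_im imset_f // (eqP (fP _ bA)).
move=> g [_ E]; apply: rvec_inj; have := fP b bA.
by rewrite /rsum -E => /eqP/addrI.
Qed.

(** By contraposition: a sum that lies in the arm has a summand in the arm. *)
Lemma source_closed alpha : closed_pattern (source alpha).
Proof.
apply/closed_patternP=> b c d; rewrite !in_setC !in_arm => bS cS bcd.
apply/negP=> dA; case/rsum_shape: bcd.
  move/(arm_idx_sum (rshapeP alpha) (rshapeP _) (rshapeP _) (rshapeP _))/(_ dA).
  by rewrite (negbTE bS) (negbTE cS).
move/(arm_idx_sum (rshapeP alpha) (rshapeP _) (rshapeP _) (rshapeP _))/(_ dA).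
by rewrite (negbTE bS) (negbTE cS).
Qed.

(** The roots with a partial sum exceeding that of alpha form a normal pattern
    that avoids alpha, hence are contained in k(alpha). *)
Lemma kset_psum alpha delta x : delta \notin kset alpha ->
  (psum (rshape delta) x <= psum (rshape alpha) x)%N.
Proof.
move=> dk; rewrite leqNgt; apply: contra dk => lt.
pose N := [set g : root | (psum (rshape alpha) x < psum (rshape g) x)%N].
have [_ _ kM] := kset_largest alpha; apply: (subsetP (kM N _ _)); rewrite ?inE ?ltnn //.
apply/normal_patternP; split; first exact: subsetT.
move=> b c d; rewrite !inE => bN _ /rsum_shape bcd.
apply: leq_trans bN _.
case: bcd => /(psumD x (rshapeP _) (rshapeP _) (rshapeP d))->; first exact: leq_addr.
exact: leq_addl.
Qed.

Lemma legk_normalT alpha gamma sigma delta : gamma \in leg alpha ->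
  rsum gamma sigma delta -> delta \notin kset alpha ->
  delta = alpha \/ delta \in leg alpha.
Proof.
rewrite !in_leg => gL gsd dk.
suff /orP[/eq_idxP E | ->] : eq_idx (rshape delta) (rshape alpha) ||
    leg_idx Y (rshape alpha) (rshape delta); [by left; apply: val_inj | by right |].
case/rsum_shape: gsd => S.
  apply: leg_idx_sum S _ (fun x => kset_psum x dk); rewrite ?rshapeP //.
  by rewrite gL.
apply: leg_idx_sum S _ (fun x => kset_psum x dk); rewrite ?rshapeP //.
by rewrite gL orbT.
Qed.

(** Reaching alpha by adding positive roots one at a time. *)
Inductive below alpha : root -> Prop :=
  | below_refl : below alpha alpha
  | below_step gamma beta delta of rsum gamma beta delta & below alpha delta :
      below alpha gamma.

(** The roots from which alpha cannot be reached form a normal pattern that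
    avoids alpha. *)
Lemma kset_below alpha delta : delta \notin kset alpha -> below alpha delta.
Proof.
pose e : rel root := [rel g d | [exists b, rsum g b d]].
move=> dk; suff: connect e delta alpha.
  case/connectP=> p; elim: p delta {dk} => [|c p IH] d /=; first by move=> _ ->; left.
  case/andP=> /existsP[b dbc] pth lst.
  by apply: below_step dbc (IH _ pth lst).
apply: contraR dk => dk; pose N := [set g | ~~ connect e g alpha].
have [_ _ kM] := kset_largest alpha.
apply: (subsetP (kM N _ _)); rewrite ?inE ?connect0 //.
apply/normal_patternP; split; first exact: subsetT.
move=> b c d; rewrite !inE => bN _ bcd; apply: contra bN => /(connect_trans _); apply.
by apply: connect1; apply/existsP; exists c.
Qed.

Lemma below_ht alpha gamma : below alpha gamma ->
  gamma = alpha \/ (ht gamma < ht alpha)%N.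
Proof.
elim=> [|g b d /htD E _ IH]; first by left.
right; have := ht_gt0 b; case: IH => [<- | ]; lia.
Qed.

Lemma kset_ht alpha gamma : (ht alpha <= ht gamma)%N -> gamma != alpha ->
  gamma \in kset alpha.
Proof.
move=> le ne; apply: contraLR le => /kset_below/below_ht[E|]; last by rewrite ltnNge.
by rewrite E eqxx in ne.
Qed.

Lemma kset_normal alpha : normal_pattern (kset alpha) setT.
Proof. by case: (kset_largest alpha). Qed.

Lemma kset_sum alpha beta gamma delta : beta \in kset alpha ->
  rsum beta gamma delta -> delta \in kset alpha.
Proof.
move=> bk bgd; have /normal_patternP[_ H] := kset_normal alpha.
exact: H bk (in_setT gamma) bgd.
Qed.

Lemma notin_kset alpha : alpha \notin kset alpha.
Proof. by case: (kset_largest alpha). Qed.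

Lemma hook_notin_kset alpha beta gamma : rsum beta gamma alpha ->
  beta \notin kset alpha.
Proof.
by move=> bg; apply/negP=> bk; move: (notin_kset alpha); rewrite (kset_sum bk bg).
Qed.

Lemma leg_notin_kset alpha gamma : gamma \in leg alpha -> gamma \notin kset alpha.
Proof. by case/legP=> b _; rewrite rsumC; apply: hook_notin_kset. Qed.

Lemma sourceE alpha gamma : (gamma \in source alpha) = (gamma \notin arm alpha).
Proof. by rewrite in_setC. Qed.

Lemma kset_source alpha gamma : gamma \in kset alpha -> gamma \in source alpha.
Proof.
rewrite sourceE; apply: contraL => /arm_hook[c]; exact: hook_notin_kset.
Qed.

Lemma leg_source alpha gamma : gamma \in leg alpha -> gamma \in source alpha.
Proof. by rewrite sourceE; apply: leg_notin_arm. Qed.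

Lemma root_source alpha : alpha \in source alpha.
Proof.
by rewrite sourceE; apply/negP=> /arm_hook[c /rsum_neq]; rewrite eqxx andbF.
Qed.

Lemma legk_normal alpha : normal_pattern (leg alpha :|: kset alpha) (source alpha).
Proof.
apply/normal_patternP; split.
  by apply/subsetP=> g /setUP[/leg_source | /kset_source].
move=> b c d /setUP[bL | bk] cS bcd; rewrite in_setU; last first.
  by rewrite (kset_sum bk bcd) orbT.
have [|dk] := boolP (d \in kset alpha); rewrite ?orbT // orbF.
case: (legk_normalT bL bcd dk) => // E; subst d.
case/orP: (arm_leg_rsum bcd) => /and3P[].
  by rewrite (negbTE (leg_notin_arm bL)).
by rewrite sourceE in cS; rewrite (negbTE cS).
Qed.

Lemma hookk_normal alpha : normal_pattern (alpha |: leg alpha :|: kset alpha) setT.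
Proof.
apply/normal_patternP; split; first exact: subsetT.
move=> b c d /setUP[/setU1P[->|bL] | bk] _ bcd; rewrite in_setU; last first.
- by rewrite (kset_sum bk bcd) orbT.
- have [|dk] := boolP (d \in kset alpha); rewrite ?orbT // orbF in_setU1.
  by case: (legk_normalT bL bcd dk) => ->; rewrite ?eqxx ?orbT.
rewrite kset_ht ?orbT //; first by rewrite (htD bcd) leq_addr.
by have /andP[_] := rsum_neq bcd; rewrite eq_sym.
Qed.

Lemma leg_cap_kset alpha : leg alpha :&: kset alpha = set0.
Proof.
apply/setP=> g; rewrite !in_setI in_set0; apply/negbTE/negP=> /andP[gL].
by rewrite (negbTE (leg_notin_kset gL)).
Qed.

Lemma source_minus_normal alpha : normal_pattern (source alpha :\ alpha) (source alpha).
Proof.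
apply/normal_patternP; split; first exact: subD1set.
move=> b c d /setD1P[ba bS] cS bcd; apply/setD1P; split; last first.
  exact: (closed_patternP _ (source_closed alpha) _ _ _ bS cS bcd).
apply/eqP=> E; subst d; rewrite !sourceE in bS cS.
by case/orP: (arm_leg_rsum bcd) => /and3P[]; rewrite ?(negbTE bS) ?(negbTE cS).
Qed.
End Roots.

(** * Commutators of exponentials of nilpotent matrices *)

(** The identities below reduce a commutator formula to the vanishing of, and
    linear relations between, products of two root vectors.  Their right-hand
    sides have the form y x z, so that z is the commutator of x and y. *)
Section ExpCommutators.
Local Open Scope ring_scope.
Variables (F : comNzRingType) (N : nat).
Implicit Types (a b c d : 'M[F]_N) (t u : F).

Ltac expand rules :=
  rewrite ?(mulmxDl, mulmxDr, mulmxBl, mulmxBr, mul1mx, mulmx1, mul0mx, mulmx0,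
    mulmxN, mulNmx, scalerDr, scalerBr, scalerN, =^~ scalemxAl, =^~ scalemxAr,
    mulmxA, rules, scaler0, addr0, add0r, oppr0, scalerA).

Lemma exp_comm1 a b c t u : a *m b = b *m a + c -> a *m c = 0 -> b *m c = 0 ->
  (1%:M + t *: a) *m (1%:M + u *: b) =
  (1%:M + u *: b) *m (1%:M + t *: a) *m (1%:M + (t * u) *: c).
Proof.
move=> ab ac bc; have bac : b *m a *m c = 0 by rewrite -mulmxA ac mulmx0.
expand (bac, ab, ac, bc); mx_ring.
Qed.

(** The case (e_i - e_j) + 2 e_j: d is the root vector of 2 e_i, which is
    2 (e_i - e_j) + 2 e_j. *)
Lemma exp_comm_long a b c d t u :
    a *m b = b *m a + c -> a *m c = d -> b *m c = 0 ->
    [/\ a *m d = 0, b *m d = 0 & c *m d = 0] ->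
  (1%:M + t *: a) *m (1%:M + u *: b) =
  (1%:M + u *: b) *m (1%:M + t *: a) *m (1%:M + (t * u) *: c) *m
    (1%:M + (- (t ^+ 2 * u)) *: d).
Proof.
move=> ab ac bc [ad bd cd].
have bac : b *m a *m c = 0 by rewrite -mulmxA ac bd.
have bad : b *m a *m d = 0 by rewrite -mulmxA ad mulmx0.
have dd : d *m d = 0 by rewrite -[X in X *m _]ac -mulmxA cd mulmx0.
expand (bac, bad, ab, ac, bc, ad, bd, cd, dd); mx_ring.
Qed.

(** The case (e_i - e_j) + e_j: d is the root vector of e_i + e_j, which is
    (e_i - e_j) + 2 e_j, and b2, c2 are divided squares of b, c. *)
Lemma exp_comm_short a b b2 c c2 d t u :
    a *m b = b *m a + c -> a *m b2 = b2 *m a + b *m c - d ->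
    [/\ a *m c = 0, a *m c2 = 0, b2 *m c = 0, b *m c2 = 0 & b2 *m c2 = 0] ->
    [/\ a *m d = c2, b *m d = 0, b2 *m d = 0, c *m d = 0 & c2 *m d = 0] ->
  (1%:M + t *: a) *m (1%:M + u *: b + u ^+ 2 *: b2) =
  (1%:M + u *: b + u ^+ 2 *: b2) *m (1%:M + t *: a) *m
    (1%:M + (t * u) *: c + (t * u) ^+ 2 *: c2) *m
    (1%:M + (- (t * u ^+ 2)) *: d).
Proof.
move=> ab ab2 [ac ac2 b2c bc2 b2c2] [ad bd b2d cd c2d].
have Z (x y : 'M[F]_N) : a *m y = 0 -> x *m a *m y = 0.
  by move=> E; rewrite -mulmxA E mulmx0.
have Z' (x y : 'M[F]_N) : c *m y = 0 -> x *m c *m y = 0.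
  by move=> E; rewrite -mulmxA E mulmx0.
have bad : b *m a *m d = 0 by rewrite -mulmxA ad.
have b2ad : b2 *m a *m d = 0 by rewrite -mulmxA ad.
expand (bad, b2ad, Z b _ ac, Z b2 _ ac, Z b _ ac2, Z b2 _ ac2, Z' b _ cd,
  ab, ab2, ac, ac2, b2c, bc2, b2c2, ad, bd, b2d, cd, c2d); mx_ring.
Qed.

(** The sum of the short roots e_i and e_j, with the coefficient 2 that vanishes
    for p = 2. *)
Lemma exp_comm_short2 a a2 b b2 d t u :
    a *m b = b *m a - (d + d) ->
    [/\ a *m b2 = 0, b2 *m a = 0, a2 *m b = 0, b *m a2 = 0 & a2 *m b2 = 0] ->
    [/\ b2 *m a2 = 0, a *m d = 0, b *m d = 0, a2 *m d = 0 & b2 *m d = 0] ->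
  (1%:M + t *: a + t ^+ 2 *: a2) *m (1%:M + u *: b + u ^+ 2 *: b2) =
  (1%:M + u *: b + u ^+ 2 *: b2) *m (1%:M + t *: a + t ^+ 2 *: a2) *m
    (1%:M + (- 2%:R * (t * u)) *: d).
Proof.
move=> ab [ab2 b2a a2b ba2 a2b2] [b2a2 ad bd a2d b2d].
have bad : b *m a *m d = 0 by rewrite -mulmxA ad mulmx0.
expand (bad, ab, ab2, b2a, a2b, ba2, a2b2, b2a2, ad, bd, a2d, b2d); mx_ring.
Qed.

Lemma exp_commute a a2 b b2 t u :
    [/\ a *m b = b *m a, a *m b2 = b2 *m a, a2 *m b = b *m a2 & a2 *m b2 = b2 *m a2] ->
  (1%:M + t *: a + t ^+ 2 *: a2) *m (1%:M + u *: b + u ^+ 2 *: b2) =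
  (1%:M + u *: b + u ^+ 2 *: b2) *m (1%:M + t *: a + t ^+ 2 *: a2).
Proof.
move=> [ab ab2 a2b a2b2].
expand (ab, ab2, a2b, a2b2); mx_ring.
Qed.
End ExpCommutators.

(** * Products of root vectors and commutators of root elements *)

Ltac prods rules :=
  rewrite /= ?mulr2n ?(mulmxDl, mulmxDr, mulmxN, mulNmx, mul_delta_mx_cond, rules,
    eqxx, mulr1n, mulr0n, oppr0, addr0, add0r, opprK, mul0mx, mulmx0).

Section RootMatrices.
Local Open Scope ring_scope.
#[local] Arguments natdim : simpl never.
#[local] Arguments ambdim : simpl never.
Variables (n : nat) (F : finFieldType).

Lemma distinct (T : eqType) (a b : T) :
  a != b -> ((a == b) = false) * ((b == a) = false).
Proof. by move=> ab; split; apply/negbTE; rewrite // eq_sym. Qed.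

Lemma wneg_wpos Y (YA : notA Y) (i j : 'I_(ambdim Y n)) :
  ((wneg i == wpos j) = false) * ((wpos j == wneg i) = false).
Proof. by split; [|rewrite eq_sym]; apply: wneg_neq_wpos. Qed.

Lemma wzero_neq (i : 'I_(ambdim TypeB n)) :
  (((wneg i == wzero TypeB n) = false) * ((wzero TypeB n == wneg i) = false)) *
  (((wpos i == wzero TypeB n) = false) * ((wzero TypeB n == wpos i) = false)).
Proof.
have z := @wzero_eq _ n i erefl; rewrite ![wzero _ _ == _]eq_sym !z.
by do !split.
Qed.

(** The lemmas rv_XY provide the hypotheses of the identities of the previous part
    for a sum of two roots of kinds X and Y, among Minus, Plus, Short and Long;
    rv_MPL is the case where this sum is 2 e_i. *)
Lemma rv_MM Y (i j k : 'I_(ambdim Y n)) : i != j -> j != k -> i != k ->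
  let e := @root_vector Y n F in
  [/\ e (Minus i j) *m e (Minus j k) = e (Minus j k) *m e (Minus i j) + e (Minus i k),
      e (Minus i j) *m e (Minus i k) = 0
    & e (Minus j k) *m e (Minus i k) = 0].
Proof.
move=> /distinct ij /distinct jk /distinct ik.
have W := @wneg_wpos Y.
case: Y i j k ij jk ik W => i j k ij jk ik W; try (have {}W := W isT); split;
  prods (wpos_eq, wneg_eq, W, ij, jk, ik); rewrite //; mx_ring.
Qed.

Lemma rv_MP Y (i j k : 'I_(ambdim Y n)) :
  notA Y -> i != j -> j != k -> i != k ->
  let e := @root_vector Y n F in
  [/\ e (Minus i j) *m e (Plus j k) = e (Plus j k) *m e (Minus i j) + e (Plus i k),
      e (Minus i j) *m e (Plus i k) = 0
    & e (Plus j k) *m e (Plus i k) = 0].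
Proof.
move=> YA /distinct ij /distinct jk /distinct ik.
have W := wneg_wpos YA.
case: Y i j k ij jk ik YA W => i j k ij jk ik // _ W; split;
  prods (wpos_eq, wneg_eq, W, ij, jk, ik); rewrite //; mx_ring.
Qed.

(** Exchanging i and j in the formula for the root vector of e_i + e_j changes
    its sign in types B and D, and does nothing in type C.  It lets one commutator
    formula serve for all positions of k in (e_i - e_j) + (e_j + e_k). *)
Definition plus_sign Y : F := if Y is TypeC then 1 else -1.

Lemma root_mx_PlusC Y (i j : 'I_(ambdim Y n)) t :
  root_mx (Plus i j) t = root_mx (Plus j i) (plus_sign Y * t) :> 'M[F]__.
Proof.
rewrite /root_mx /plus_sign; case: Y i j => i j /=; mx_ring.
Qed.

Lemma rv_MPL (i j : 'I_(ambdim TypeC n)) : i != j ->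
  let e := @root_vector TypeC n F in
  [/\ e (Minus i j) *m e (Plus i j) = e (Plus i j) *m e (Minus i j) + 2%:R *: e (Long i),
      e (Minus i j) *m e (Long i) = 0
    & e (Plus i j) *m e (Long i) = 0].
Proof.
move=> /distinct ij; have W := @wneg_wpos TypeC isT.
split; prods (wpos_eq, wneg_eq, W, ij); rewrite //; mx_ring.
Qed.

Lemma rv_ML (i j : 'I_(ambdim TypeC n)) : i != j ->
  let e := @root_vector TypeC n F in
  [/\ e (Minus i j) *m e (Long j) = e (Long j) *m e (Minus i j) + e (Plus i j),
      e (Minus i j) *m e (Plus i j) = e (Long i),
      e (Long j) *m e (Plus i j) = 0
    & [/\ e (Minus i j) *m e (Long i) = 0, e (Long j) *m e (Long i) = 0
        & e (Plus i j) *m e (Long i) = 0]].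
Proof.
move=> /distinct ij; have W := @wneg_wpos TypeC isT.
split; last split; prods (wpos_eq, wneg_eq, W, ij); rewrite //; mx_ring.
Qed.

Lemma rv_MS (i j : 'I_(ambdim TypeB n)) : i != j ->
  let e := @root_vector TypeB n F in let e2 := @root_vector2 TypeB n F in
  let a := e (Minus i j) in let b := e (Short j) in let b2 := e2 (Short j) in
  let c := e (Short i) in let c2 := e2 (Short i) in let d := e (Plus i j) in
  [/\ a *m b = b *m a + c, a *m b2 = b2 *m a + b *m c - d,
      [/\ a *m c = 0, a *m c2 = 0, b2 *m c = 0, b *m c2 = 0 & b2 *m c2 = 0]
    & [/\ a *m d = c2, b *m d = 0, b2 *m d = 0, c *m d = 0 & c2 *m d = 0]].
Proof.
move=> /distinct ij; have W := @wneg_wpos TypeB isT; have Z := wzero_neq.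
split; [| |split|split]; prods (wpos_eq, wneg_eq, W, Z, ij); rewrite //; mx_ring.
Qed.

Lemma rv_SS (i j : 'I_(ambdim TypeB n)) : i != j ->
  let e := @root_vector TypeB n F in let e2 := @root_vector2 TypeB n F in
  let a := e (Short i) in let a2 := e2 (Short i) in
  let b := e (Short j) in let b2 := e2 (Short j) in let d := e (Plus i j) in
  [/\ a *m b = b *m a - (d + d),
      [/\ a *m b2 = 0, b2 *m a = 0, a2 *m b = 0, b *m a2 = 0 & a2 *m b2 = 0]
    & [/\ b2 *m a2 = 0, a *m d = 0, b *m d = 0, a2 *m d = 0 & b2 *m d = 0]].
Proof.
move=> /distinct ij; have W := @wneg_wpos TypeB isT; have Z := wzero_neq.
split; [|split|split]; prods (wpos_eq, wneg_eq, W, Z, ij); rewrite //; mx_ring.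
Qed.

Lemma root_mxE Y (c : shape (ambdim Y n)) (t : F) :
  (if c is Short _ then false else true) ->
  root_mx c t = 1%:M + t *: root_vector F c.
Proof. by case: c => //= *; rewrite /root_mx scaler0 addr0. Qed.

End RootMatrices.

Lemma Plus_nonA Y m (i j : 'I_m) : is_posroot Y (Plus i j) -> notA Y.
Proof. by case: Y. Qed.

Lemma Short_B Y m (i : 'I_m) : is_posroot Y (Short i) -> Y = TypeB.
Proof. by case: Y. Qed.

Lemma Long_C Y m (i : 'I_m) : is_posroot Y (Long i) -> Y = TypeC.
Proof. by case: Y. Qed.

(** Conditions on the indices under which all products of the two root vectors
    that occur vanish, with two exceptions: e_i - e_j and e_i + e_j in types B
    and D, whose root vectors have equal products in both orders, and two equal
    roots e_i. *)
Definition commute_idx Y m (a b : shape m) : bool :=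
  match a, b with
  | Minus i j, Minus k l => (j != k) && (l != i)
  | Minus i j, Plus k l =>
      (j != k) && ((j != l) || (i == k) && (if Y is TypeC then false else true))
  | Minus i j, Short k => j != k
  | Minus i j, Long k => j != k
  | Plus _ _, Plus _ _ | Plus _ _, Short _ | Plus _ _, Long _
  | Long _, Long _ => true
  | Short i, Short j => i == j
  | _, _ => false
  end.

Lemma Short_Plus Y m (i k l : 'I_m) : is_posroot Y (Short i) -> (k < l)%N ->
  is_posroot Y (Plus k l).
Proof. by case: Y. Qed.

Definition no_sum Y m (a b : shape m) :=
  forall c, is_posroot Y c -> (shape_vec c != shape_vec a + shape_vec b)%R.

Lemma no_sumC Y m (a b : shape m) : no_sum Y a b -> no_sum Y b a.
Proof. by move=> H c /H; rewrite addrC. Qed.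

Lemma nosum_MM Y m (i j k l : 'I_m) :
    is_posroot Y (Minus i j) -> is_posroot Y (Minus k l) ->
  no_sum Y (Minus i j) (Minus k l) -> j != k.
Proof.
move=> /= ij kl H; apply/eqP=> E; subst k.
move: (H (Minus i l) (ltn_trans ij kl)); rewrite /= addrA subrK eqxx //.
Qed.

Lemma nosum_idx Y m (a b : shape m) :
    is_posroot Y a -> is_posroot Y b -> no_sum Y a b ->
  commute_idx Y a b || commute_idx Y b a.
Proof.
have MP i j k l : is_posroot Y (@Minus m i j) -> is_posroot Y (@Plus m k l) ->
    no_sum Y (Minus i j) (Plus k l) -> commute_idx Y (Minus i j) (Plus k l).
  move=> /= ij kl H.
  have jk : j != k.
    apply/eqP=> E; subst k; have jl := Plus_lt kl.
    case/negP: (H (Plus i l) (posroot_Plus kl (ltn_trans ij jl))).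
    by apply/eqP; mx_ring.
  rewrite jk /=; have [E|//] := eqVneq j l; subst l => /=.
  have [E|ik] := eqVneq i k.
    subst k.
    have -> : (if Y is TypeC then false else true) = ~~ is_posroot Y (Long i).
      by case: (Y).
    apply/negP=> LP; case/negP: (H (Long i) LP).
    by apply/eqP; mx_ring.
  case: (ltngtP i k) => [lt|gt|E]; last by case/eqP: ik; apply: val_inj.
    case/negP: (H (Plus i k) (posroot_Plus kl lt)).
    by apply/eqP; mx_ring.
  case/negP: (H (Plus k i) (posroot_Plus kl gt)).
  by apply/eqP; mx_ring.
have MS i j k : is_posroot Y (@Minus m i j) -> is_posroot Y (@Short m k) ->
    no_sum Y (Minus i j) (Short k) -> commute_idx Y (Minus i j) (Short k).
  move=> /= ij kP H; apply/eqP=> E; subst k; case/negP: (H (Short i) kP).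
  by apply/eqP; mx_ring.
have ML i j k : is_posroot Y (@Minus m i j) -> is_posroot Y (@Long m k) ->
    no_sum Y (Minus i j) (Long k) -> commute_idx Y (Minus i j) (Long k).
  move=> /= ij kP H; apply/eqP=> E; subst k.
  case/negP: (H (Plus i j) (@Long_Plus _ _ j _ _ kP ij)).
  by apply/eqP; mx_ring.
case: a b => [i j|i j|i|i] [k l|k l|k|k] aP bP H //.
all: try by rewrite /= ?orbT.
- by rewrite /= (nosum_MM aP bP H) (nosum_MM bP aP) //; apply: no_sumC.
- by rewrite MP.
- by rewrite MS.
- by rewrite ML.
- by rewrite orbC MP //; apply: no_sumC.
- by rewrite orbC MS //; apply: no_sumC.
- rewrite /=; case: (ltngtP i k) => [lt|gt|E]; last by rewrite (val_inj E) eqxx.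
    by case/negP: (H (Plus i k) (Short_Plus aP lt)).
  by case/negP: (H (Plus k i) (Short_Plus aP gt)); rewrite /= addrC.
- by clear -aP bP; case: Y aP bP.
- by rewrite orbC ML //; apply: no_sumC.
- by clear -aP bP; case: Y aP bP.
Qed.

Section RootCommutators.
Local Open Scope ring_scope.
#[local] Arguments natdim : simpl never.
#[local] Arguments ambdim : simpl never.
Variables (Y : dynkin) (n : nat) (F : finFieldType).

Lemma commute_idx_comm (a b : shape (ambdim Y n)) t u :
    is_posroot Y a -> is_posroot Y b -> commute_idx Y a b ->
  root_mx a t *m root_mx b u = root_mx b u *m root_mx a t :> 'M[F]__.
Proof.
move=> aP bP.
have W Y' := @wneg_wpos n Y'; have Z := @wzero_neq n.
case: Y a b aP bP => [] [i j|i j|i|i] [k l|k l|k|k] //= aP bP.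
- case/andP=> /distinct jk /distinct li; apply: exp_commute.
  by split; prods (wpos_eq, jk, li).
- case/andP=> /distinct jk /distinct li; apply: exp_commute.
  by split; prods (wpos_eq, wneg_eq, W TypeB isT, jk, li).
- case/andP=> /distinct jk /orP[/distinct jl | /andP[/eqP ik _]].
    by apply: exp_commute; split; prods (wpos_eq, wneg_eq, W TypeB isT, jk, jl).
  have [/eqP E|/distinct jl] := boolP (j == l); last first.
    by apply: exp_commute; split; prods (wpos_eq, wneg_eq, W TypeB isT, jk, jl).
  by subst k l; apply: exp_commute; split; prods (wpos_eq, wneg_eq, W TypeB isT, jk).
- move=> /distinct jk; apply: exp_commute.
  by split; prods (wpos_eq, wneg_eq, W TypeB isT, Z, jk).
- by move=> _; apply: exp_commute; split; prods (W TypeB isT).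
- by move=> _; apply: exp_commute; split; prods (W TypeB isT, Z).
- by move=> /eqP->; rewrite -!root_mxD // addrC.
- case/andP=> /distinct jk /distinct li; apply: exp_commute.
  by split; prods (wpos_eq, wneg_eq, W TypeC isT, jk, li).
- case/andP=> /distinct jk; rewrite andbF orbF => /distinct jl.
  by apply: exp_commute; split; prods (wpos_eq, wneg_eq, W TypeC isT, jk, jl).
- move=> /distinct jk; apply: exp_commute.
  by split; prods (wpos_eq, wneg_eq, W TypeC isT, jk).
- by move=> _; apply: exp_commute; split; prods (W TypeC isT).
- by move=> _; apply: exp_commute; split; prods (W TypeC isT).
- by move=> _; apply: exp_commute; split; prods (W TypeC isT).
- case/andP=> /distinct jk /distinct li; apply: exp_commute.
  by split; prods (wpos_eq, wneg_eq, W TypeD isT, jk, li).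
- case/andP=> /distinct jk /orP[/distinct jl | /andP[/eqP ik _]].
    by apply: exp_commute; split; prods (wpos_eq, wneg_eq, W TypeD isT, jk, jl).
  have [/eqP E|/distinct jl] := boolP (j == l); last first.
    by apply: exp_commute; split; prods (wpos_eq, wneg_eq, W TypeD isT, jk, jl).
  by subst k l; apply: exp_commute; split; prods (wpos_eq, wneg_eq, W TypeD isT, jk).
- by move=> _; apply: exp_commute; split; prods (W TypeD isT).
Qed.

Lemma root_comm_nosum (a b : shape (ambdim Y n)) t u :
    is_posroot Y a -> is_posroot Y b -> no_sum Y a b ->
  root_mx a t *m root_mx b u = root_mx b u *m root_mx a t :> 'M[F]__.
Proof.
move=> aP bP H; have : commute_idx Y a b || commute_idx Y b a.
  exact: nosum_idx.
by case/orP=> C; [|symmetry]; apply: commute_idx_comm.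
Qed.

Hypothesis two_neq0 : Y = TypeB \/ Y = TypeC -> 2%:R != 0 :> F.

Lemma neq_lt m (i j : 'I_m) : (i < j)%N -> i != j.
Proof. by move=> ij; rewrite -val_eqE ltn_eqF. Qed.

(** The coefficient k is 1, -1, 2 or -2, the last two occurring only for the sums
    2 e_i in type C and e_i + e_j of short roots in type B.  The rest z is
    nontrivial only for (e_i - e_j) + e_j and (e_i - e_j) + 2 e_j. *)
Lemma root_comm_sum (a b c : shape (ambdim Y n)) :
    is_posroot Y a -> is_posroot Y b -> is_posroot Y c -> sum_shape a b c ->
  exists2 k : F, k != 0 & forall t u, exists2 z,
    z = 1%:M \/ exists2 d, is_posroot Y d /\
      (shape_vec d = shape_vec c + shape_vec a \/
       shape_vec d = shape_vec c + shape_vec b) & exists s, z = root_mx d s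
  & root_mx a t *m root_mx b u =
    root_mx b u *m root_mx a t *m root_mx c (k * (t * u)) *m z.
Proof.
have s2 : plus_sign F Y * plus_sign F Y = 1.
  by rewrite /plus_sign; case: (Y); rewrite ?mulrNN ?mulr1.
have sN0 : plus_sign F Y != 0.
  by rewrite /plus_sign; case: (Y); rewrite ?oppr_eq0 oner_eq0.
have MP (i j k : 'I_(ambdim Y n)) (t u : F) :
    (i < j)%N -> j != k -> i != k ->
    is_posroot Y (Plus j k) || is_posroot Y (Plus k j) ->
    root_mx (Minus i j) t *m root_mx (Plus j k) u =
    root_mx (Plus j k) u *m root_mx (Minus i j) t *m root_mx (Plus i k) (t * u) :> 'M[F]__.
  move=> /neq_lt ij jk ik P; rewrite !root_mxE //.
  have YA : notA Y by case/orP: P => /Plus_nonA.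
  by have [ab ac bc] := rv_MP F YA ij jk ik; apply: exp_comm1.
move=> + + + s; case: s => [i j k|i j k|i j k|i j k|i j|i j|i j|i j] aP bP cP.
- exists 1; rewrite ?oner_eq0 // => t u; exists 1%:M; first by left.
  rewrite mulmx1 mul1r !root_mxE //.
  have [ab ac bc] := rv_MM F (neq_lt aP) (neq_lt bP) (neq_lt cP).
  exact: exp_comm1.
- exists 1; rewrite ?oner_eq0 // => t u; exists 1%:M; first by left.
  rewrite mulmx1 mul1r MP ?bP // ?(neq_lt (Plus_lt bP)) ?(neq_lt (Plus_lt cP)) //.
- exists (plus_sign F Y) => // t u; exists 1%:M; first by left.
  rewrite mulmx1 (root_mx_PlusC k j) MP ?bP ?orbT // ?(neq_lt (Plus_lt cP)) //.
    by rewrite (mulrCA t).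
  by rewrite eq_sym (neq_lt (Plus_lt bP)).
- exists 1; rewrite ?oner_eq0 // => t u; exists 1%:M; first by left.
  rewrite mulmx1 mul1r (root_mx_PlusC k j) (root_mx_PlusC k i).
  rewrite MP ?bP ?orbT // 1?eq_sym ?(neq_lt (Plus_lt cP)) ?(neq_lt (Plus_lt bP)) //.
  by rewrite (mulrCA t).
- have YC := Long_C cP.
  exists 2%:R => [|t u]; first by apply: two_neq0; right.
  exists 1%:M; first by left.
  subst Y; have [ab ac bc] := rv_MPL F (neq_lt aP).
  rewrite mulmx1 !root_mxE // (mulrC 2%:R) -scalerA.
  by apply: exp_comm1; rewrite // -scalemxAr ?ac ?bc scaler0.
- have YB := Short_B cP.
  subst Y; exists 1; rewrite ?oner_eq0 // => t u.
  exists (root_mx (Plus i j) (- (t * u ^+ 2))).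
    right; exists (Plus i j); last by exists (- (t * u ^+ 2)).
    by split; [exact: aP | right].
  have [ab ab2 H1 H2] := rv_MS F (neq_lt aP).
  rewrite mul1r !(@root_mxE _ _ _ (Minus _ _)) // (@root_mxE _ _ _ (Plus _ _)) //.
  exact: exp_comm_short ab ab2 H1 H2.
- have YC := Long_C bP.
  subst Y; exists 1; rewrite ?oner_eq0 // => t u.
  exists (root_mx (Long i) (- (t ^+ 2 * u))).
    right; exists (Long i); last by exists (- (t ^+ 2 * u)).
    split=> //; left; rewrite /= mulr2n.
    by rewrite addrACA subrr addr0.
  have [ab ac bc H] := rv_ML F (neq_lt aP).
  rewrite mul1r !root_mxE //.
  exact: exp_comm_long ab ac bc H.
- have YB := Short_B aP.
  exists (- 2%:R) => [|t u]; first by rewrite oppr_eq0; apply: two_neq0; left.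
  exists 1%:M; first by left.
  subst Y; have [ab H1 H2] := rv_SS F (neq_lt (Plus_lt cP)).
  rewrite mulmx1 (@root_mxE _ _ _ (Plus _ _)) //.
  exact: exp_comm_short2 ab H1 H2.
Qed.

End RootCommutators.

(** * Pattern groups *)

Section PatternGroups.
Local Open Scope group_scope.
Variables (Y : dynkin) (n : nat) (F : finFieldType) (gT : finGroupType).
Local Notation root := (posroot Y n).
Implicit Types (alpha beta gamma delta : root) (S N Q R : {set root}) (t u : F).

Definition comm_rest (x : root -> F -> gT) beta gamma delta z :=
  z = 1 \/ exists2 delta', rsum delta beta delta' \/ rsum delta gamma delta'
    & exists s, z = x delta' s.

Definition comm_form (x : root -> F -> gT) beta gamma delta (c : F) := forall t u,
  exists2 z, comm_rest x beta gamma delta z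
    & [~ x beta t, x gamma u] = x delta (c * (t * u))%R * z.

(** What the proof uses of the root elements.  In [rsg_indep] the group H
    contains every root subgroup of at least the height of gamma except that of
    gamma, which it meets trivially. *)
Record root_system_group (x : root -> F -> gT) : Prop := RootSystemGroup {
  rsgD : forall gamma t u, x gamma (t + u)%R = x gamma t * x gamma u;
  rsg_comm : forall beta gamma delta, rsum beta gamma delta ->
    exists2 c, c != 0%R &
      comm_form x beta gamma delta c \/ comm_form x gamma beta delta c;
  rsg_commute : forall beta gamma t u, (forall delta, ~~ rsum beta gamma delta) ->
    commute (x beta t) (x gamma u);
  rsg_indep : forall gamma, exists2 H : {group gT},
    forall delta t, delta != gamma -> (ht gamma <= ht delta)%N -> x delta t \in H
    & forall t, x gamma t \in H -> t = 0%R
}.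

Variable x : root -> F -> gT.
Hypothesis xP : root_system_group x.

Definition root_group gamma : {set gT} := [set x gamma t | t : F].

Definition pattern S : {group gT} := <<\bigcup_(gamma in S) root_group gamma>>%G.

Local Notation X := root_group.
Local Notation P := pattern.

Lemma rsg0 gamma : x gamma 0%R = 1.
Proof. by apply: (mulgI (x gamma 0%R)); rewrite -(rsgD xP) addr0 mulg1. Qed.

Lemma rsgN gamma t : x gamma (- t)%R = (x gamma t)^-1.
Proof.
by apply: (mulgI (x gamma t)); rewrite -(rsgD xP) subrr rsg0 mulgV.
Qed.

Lemma rootgP gamma y : reflect (exists t, y = x gamma t) (y \in X gamma).
Proof.
apply: (iffP imsetP) => [[t _ ->] | [t ->]]; first by exists t.
by exists t.
Qed.

Lemma mem_rootg gamma t : x gamma t \in X gamma.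
Proof. by apply/rootgP; exists t. Qed.

Lemma rootg_group_set gamma : group_set (X gamma).
Proof.
apply/group_setP; split; first by rewrite -(rsg0 gamma) mem_rootg.
by move=> _ _ /rootgP[t ->] /rootgP[u ->]; rewrite -(rsgD xP) mem_rootg.
Qed.

Definition rootG gamma := Group (rootg_group_set gamma).

Lemma rootg_abelian gamma : abelian (X gamma).
Proof.
apply/centsP=> _ /rootgP[t ->] _ /rootgP[u ->].
by rewrite /commute -!(rsgD xP) addrC.
Qed.

Lemma mem_pattern gamma t S : gamma \in S -> x gamma t \in P S.
Proof. by move=> gS; apply/mem_gen/bigcupP; exists gamma; last exact: mem_rootg. Qed.

Lemma rootg_pattern gamma S : gamma \in S -> X gamma \subset P S.
Proof. by move=> gS; apply/subsetP=> _ /rootgP[t ->]; apply: mem_pattern. Qed.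

Lemma pattern_subG S (H : {group gT}) :
  (forall gamma t, gamma \in S -> x gamma t \in H) -> P S \subset H.
Proof.
move=> sXH; rewrite gen_subG; apply/bigcupsP=> g gS.
by apply/subsetP=> _ /rootgP[t ->]; apply: sXH.
Qed.

Lemma patternS S N : S \subset N -> P S \subset P N.
Proof. by move=> /subsetP sSN; apply: pattern_subG => g t /sSN; apply: mem_pattern. Qed.

(** The closure conditions on Q cover the further roots beta + 2 gamma and
    2 beta + gamma that occur in types B and C. *)
Lemma comm_mem_pattern Q beta gamma t u :
  (forall delta, rsum beta gamma delta -> delta \in Q) ->
  (forall delta delta', delta \in Q -> rsum delta beta delta' -> delta' \in Q) ->
  (forall delta delta', delta \in Q -> rsum delta gamma delta' -> delta' \in Q) ->
  [~ x beta t, x gamma u] \in P Q.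
Proof.
move=> Q0 Qb Qg.
have [/existsP[d bgd]|] := boolP [exists d, rsum beta gamma d]; last first.
  rewrite negb_exists => /forallP H.
  by move: (rsg_commute xP t u H) => /commgP/eqP->; apply: group1.
have dQ := Q0 _ bgd; have [c _ H] := rsg_comm xP bgd.
have zQ b g z : comm_rest x b g d z -> [\/ b = beta /\ g = gamma | b = gamma /\ g = beta] ->
    z \in P Q.
  case=> [-> _|[d' S [s ->]] bg]; first exact: group1.
  apply: mem_pattern.
  by case: bg S => -[-> ->] [] S; [apply: Qb S | apply: Qg S | apply: Qg S | apply: Qb S].
case: H => H.
  have [z zP ->] := H t u.
  by rewrite groupM ?mem_pattern // (zQ _ _ _ zP) //; left.
have [z zP E] := H u t.
rewrite -groupV invg_comm E.
by rewrite groupM ?mem_pattern // (zQ _ _ _ zP) //; right.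
Qed.

Lemma pattern_norm N S : normal_pattern N S -> P S \subset 'N(P N).
Proof.
case/normal_patternP=> /subsetP sNS H; apply: pattern_subG => g u gS.
rewrite inE -genJ gen_subG.
apply/subsetP=> _ /imsetP[y /bigcupP[b bN /rootgP[t ->]] ->].
rewrite conjg_mulR groupM ?mem_pattern //.
apply: comm_mem_pattern => [d | d d' dN | d d' dN]; first exact: H.
  by apply: H => //; apply: sNS.
exact: H.
Qed.

Lemma pattern_normal N S : normal_pattern N S -> P N <| P S.
Proof.
move=> nNS; rewrite /normal pattern_norm // patternS //.
by case/normal_patternP: nNS.
Qed.

Lemma pattern_commg Q R N S : normal_pattern Q R -> N \subset R -> S \subset R ->
    (forall beta gamma delta, beta \in N -> gamma \in S -> rsum beta gamma delta ->
       delta \in Q) ->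
  [~: P N, P S] \subset P Q.
Proof.
move=> nQR sNR sSR H; have nQ := pattern_norm nQR.
have [_ HQ] := normal_patternP _ _ nQR.
have nQN := subset_trans (patternS sNR) nQ; have nQS := subset_trans (patternS sSR) nQ.
rewrite -quotient_cents2 // !quotient_gen; first last.
- exact: subset_trans (sub_gen (subxx _)) nQN.
- exact: subset_trans (sub_gen (subxx _)) nQS.
rewrite cent_gen gen_subG quotient_cents2r //.
rewrite gen_subG; apply/subsetP=> _ /imset2P[y1 y2 y1N y2S ->].
case/bigcupP: y1N => b bN /rootgP[t ->].
case/bigcupP: y2S => g gS /rootgP[u ->].
apply: comm_mem_pattern => [d | d d' dQ | d d' dQ]; first exact: H.
  exact: HQ dQ (subsetP sNR _ bN).
exact: HQ dQ (subsetP sSR _ gS).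
Qed.

Lemma rsg_inj gamma : injective (x gamma).
Proof.
move=> t u E; apply/eqP; rewrite -subr_eq0; apply/eqP.
have [H _] := rsg_indep xP gamma; apply.
by rewrite (rsgD xP) rsgN E mulgV group1.
Qed.

Lemma card_rootg gamma : #|X gamma| = #|F|.
Proof. by rewrite card_imset //; apply: rsg_inj. Qed.

Lemma minimal_split S gamma : closed_pattern S -> gamma \in S ->
    (forall delta, delta \in S -> (ht gamma <= ht delta)%N) ->
  normal_pattern (S :\ gamma) S.
Proof.
move=> /closed_patternP cS gS gmin; apply/normal_patternP; split; first exact: subD1set.
move=> b c d /setD1P[_ bS] cS' bcd; rewrite in_setD1 (cS b c) // andbT.
apply: contraTneq (gmin _ bS) => E; move: (ht_gt0 c); rewrite -E (htD bcd); lia.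
Qed.

Lemma normal_closed N S : normal_pattern N S -> closed_pattern N.
Proof.
case/normal_patternP=> /subsetP sNS H; apply/closed_patternP=> b c d bN cN.
exact: H bN (sNS _ cN).
Qed.

Lemma pattern_mul S gamma : gamma \in S -> normal_pattern (S :\ gamma) S ->
  P (S :\ gamma) * X gamma = P S.
Proof.
move=> gS nS; have [sS nP] := andP (pattern_normal nS).
have sXS : rootG gamma \subset P S by apply: rootg_pattern.
rewrite -[X gamma]/(gval (rootG gamma)) -norm_joinEr; last exact: subset_trans sXS nP.
apply/eqP; rewrite eqEsubset join_subG sS sXS; apply: pattern_subG => d t dS.
have [->|dg] := eqVneq d gamma; first by rewrite (subsetP (joing_subr _ _)) // mem_rootg.
by rewrite (subsetP (joing_subl _ _)) // mem_pattern // in_setD1 dg.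
Qed.

(** Remove a root gamma of minimal height from S: what is left is normal in S,
    and its pattern group meets X_gamma trivially. *)
Lemma card_pattern S : closed_pattern S -> #|P S| = (#|F| ^ #|S|)%N.
Proof.
elim: {S}#|S| {-2}S (erefl #|S|) => [|k IH] S Sk cS.
  rewrite (cards0_eq Sk) cards0 /pattern /= big_pred0 ?gen0 ?cards1 // => g.
  by rewrite inE.
have /card_gt0P[g0 g0S] : (0 < #|S|)%N by rewrite Sk.
case: (@arg_minnP _ g0 [in S] (fun g => ht g) g0S) => g gS gmin.
have nS := minimal_split cS gS gmin.
have Sk' : #|S :\ g| = k by move: Sk; rewrite (cardsD1 g) gS => -[].
have [H HD Hg] := rsg_indep xP g.
rewrite -(pattern_mul gS nS) -[X g]/(gval (rootG g)) TI_cardMg.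
  by rewrite /= card_rootg (IH _ Sk' (normal_closed nS)) Sk' Sk expnSr.
apply/trivgP/subsetP=> y /setIP[yS /rootgP[t yE]].
have: x g t \in H.
  rewrite -yE; apply: subsetP yS; apply: pattern_subG => d u /setD1P[dg dS].
  by apply: HD => //; apply: gmin.
by move/Hg=> t0; rewrite yE t0 rsg0 inE.
Qed.

Lemma pattern_sdprod S gamma : closed_pattern S -> gamma \in S ->
  normal_pattern (S :\ gamma) S -> P (S :\ gamma) ><| rootG gamma = P S.
Proof.
move=> cS gS nS; have [sS nP] := andP (pattern_normal nS).
have sXS : rootG gamma \subset P S by apply: rootg_pattern.
rewrite sdprodE ?(subset_trans sXS) //=; first exact: pattern_mul.
have E := pattern_mul gS nS.
have := mul_cardG (P (S :\ gamma)) (rootG gamma).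
rewrite [gval (rootG _)]/= E card_rootg !card_pattern ?(normal_closed nS) //.
rewrite (cardsD1 gamma S) gS -expnSr add1n -[X in X = _]muln1 => /eqP.
rewrite eqn_pmul2l ?expn_gt0 ?(ltnW (finNzRing_gt1 _)) // => /eqP E1.
exact: (@card1_trivg _ (P (S :\ gamma) :&: rootG gamma)%G (esym E1)).
Qed.

(** The pairing between arm and leg comes from this: beta + 2 gamma and
    2 beta + gamma are higher than beta + gamma, hence disappear into Q. *)
Lemma leading_comm beta gamma delta Q : rsum beta gamma delta ->
  normal_pattern Q setT -> (forall delta', (ht delta < ht delta')%N -> delta' \in Q) ->
  exists2 c, c != 0%R & forall t u, exists2 z, z \in P Q &
    [~ x beta t, x gamma u] = x delta (c * (t * u))%R * z.
Proof.
move=> bgd nQ HQ; have [c c0 H] := rsg_comm xP bgd.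
have zQ b g z : comm_rest x b g delta z -> z \in P Q.
  case=> [->|[d' S [s ->]]]; first exact: group1.
  by apply: mem_pattern; apply: HQ; case: S => /htD->;
    rewrite -addn1 leq_add2l ht_gt0.
case: H => H; first by exists c => // t' u'; have [z /zQ] := H t' u'; exists z.
exists (- c)%R; rewrite ?oppr_eq0 // => t' u'; have [z /zQ zP E] := H u' t'.
exists (z^-1 ^ (x delta (c * (u' * t'))%R)^-1).
  have nx s : x delta s \in 'N(P Q).
    by apply: (subsetP (pattern_norm nQ)); apply: mem_pattern; apply: in_setT.
  by rewrite memJ_norm groupV ?nx.
rewrite -invg_comm E invMg mulNr rsgN (mulrC t') /conjg invgK.
by rewrite !mulgA mulVg mul1g.
Qed.
End PatternGroups.

(** * Independence of the root subgroups *)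

Lemma mem_nonA Y (T : eqType) (a : T) (s : seq T) :
  (a \in (if Y is TypeA then [::] else s)) =
  notA Y && (a \in s).
Proof. by case: Y. Qed.

Section Level.
Local Open Scope ring_scope.
#[local] Arguments natdim : simpl never.
#[local] Arguments ambdim : simpl never.
Variables (Y : dynkin) (n : nat) (F : finFieldType).
Local Notation index := 'I_(natdim Y n).+1.

(** Minus the weight of the r-th basis vector, as measured by the coweight of
    [ht_shape] and shifted so that the first vector has level 0.  The nonzero
    entries (r, s) of a root vector have level s = level r + ht.  Types C and D
    lack the vector of weight 0 and skip the level n. *)
Definition level (r : index) : nat :=
  match Y with
  | TypeA | TypeB => (r : nat)
  | TypeC | TypeD => if (r < n)%N then r : nat else (r : nat).+1
  end.

Definition support (c : shape (ambdim Y n)) : seq (index * index) :=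
  match c with
  | Minus i j =>
      (wpos i, wpos j) :: (if Y is TypeA then [::] else [:: (wneg j, wneg i)])
  | Plus i j => [:: (wpos i, wneg j); (wpos j, wneg i)]
  | Short i => [:: (wpos i, wzero Y n); (wzero Y n, wneg i); (wpos i, wneg i)]
  | Long i => [:: (wpos i, wneg i)]
  end.

(** A position in the support of c and of no other positive root. *)
Definition corner (c : shape (ambdim Y n)) : index * index :=
  match c with
  | Minus i j => (wpos i, wpos j)
  | Plus i j => (wpos i, wneg j)
  | Short i => (wpos i, wzero Y n)
  | Long i => (wpos i, wneg i)
  end.

Lemma ambdim_nonA : notA Y -> ambdim Y n = n.
Proof. by case: Y. Qed.

Lemma level_wpos i : level (wpos i) = i.
Proof.
rewrite /level val_wpos; move: (nat_of_ord i) (ltn_ord i).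
by rewrite /ambdim; case: Y => // k ->.
Qed.

Lemma level_wneg i : notA Y ->
  level (wneg i) = (n.*2 - i)%N.
Proof.
rewrite /level val_wneg; move: (nat_of_ord i) (ltn_ord i).
rewrite /ambdim /natdim; case: Y => // k kn _; try case: ifP; lia.
Qed.

Lemma level_wzero : Y = TypeB -> level (wzero Y n) = n.
Proof.
move=> YB; rewrite /level /wzero inordK; first by rewrite YB.
by rewrite YB /natdim -addnn; lia.
Qed.

Lemma support_level c r s : is_posroot Y c -> (r, s) \in support c ->
  (level r + ht_shape c <= level s)%N.
Proof.
have wn := level_wneg; have w0 := level_wzero.
case: c => [i j|i j|i|i] /= cP.
- rewrite inE => /orP[/eqP[-> ->]|].
    by rewrite !level_wpos subnKC // ltnW.
  rewrite mem_nonA => /andP[YA].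
  rewrite inE => /eqP[-> ->]; rewrite !wn //.
  have E := ambdim_nonA YA; have := ltn_ord j; have := ltn_ord i; lia.
- have YA := Plus_nonA cP.
  rewrite !inE => /orP[]/eqP[-> ->]; rewrite level_wpos wn //;
    have E := ambdim_nonA YA; have := ltn_ord j; have := ltn_ord i; lia.
- have YB := @Short_B Y _ i cP.
  have YA : notA Y by rewrite YB.
  have := ltn_ord i; have E : ambdim Y n = n by rewrite YB.
  rewrite !inE => lt /or3P[]/eqP[-> ->]; rewrite ?level_wpos ?wn ?w0 //; lia.
- have YC := @Long_C Y _ i cP.
  have YA : notA Y by rewrite YC.
  have := ltn_ord i; have E : ambdim Y n = n by rewrite YC.
  rewrite !inE => lt /eqP[-> ->]; rewrite ?level_wpos ?wn //; lia.
Qed.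

Lemma corner_level c : is_posroot Y c ->
  level (corner c).2 = (level (corner c).1 + ht_shape c)%N.
Proof.
have wn := level_wneg; have w0 := level_wzero.
case: c => [i j|i j|i|i] /= cP.
- by rewrite !level_wpos subnKC // ltnW.
- have YA := Plus_nonA cP; rewrite level_wpos wn //.
  have E := ambdim_nonA YA; have := ltn_ord j; have := ltn_ord i; lia.
- have YB := @Short_B Y _ i cP.
  have := ltn_ord i; have E : ambdim Y n = n by rewrite YB.
  rewrite level_wpos w0 //; lia.
- have YC := @Long_C Y _ i cP.
  have YA : notA Y by rewrite YC.
  have := ltn_ord i; have E : ambdim Y n = n by rewrite YC.
  rewrite level_wpos wn //; lia.
Qed.

Lemma support_corner c d : is_posroot Y c -> is_posroot Y d ->
  corner d \in support c -> c = d.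
Proof.
move=> cP dP cd; apply: eq_idxP; move: cd.
have wn := level_wneg; have w0 := level_wzero.
have L a b a' b' : (a, b) == (a', b') -> level a = level a' /\ level b = level b'.
  by case/eqP=> -> ->.
case: c d cP dP => [i j|i j|i|i] [k l|k l|k|k] cP dP /=;
  try (have YB := @Short_B Y _ i cP); try (have YB := @Short_B Y _ k dP);
  try (have YC := @Long_C Y _ i cP); try (have YC := @Long_C Y _ k dP);
  try (have YA := Plus_nonA cP); try (have YA := Plus_nonA dP);
  try (have YA : notA Y by rewrite ?YB ?YC);
  try (by rewrite YC in YB);
  try (have ? := ltn_ord i); try (have ? := ltn_ord j);
  try (have ? := ltn_ord k); try (have ? := ltn_ord l);
  try (have ? := Plus_lt cP); try (have ? := Plus_lt dP);
  try (have ? : (i < j)%N := cP); try (have ? : (k < l)%N := dP);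
  rewrite ?inE ?mem_nonA ?inE.
all: let rec fin := match goal with
  | |- is_true (_ || _) -> _ => case/orP; fin
  | |- is_true (_ && _) -> _ => case/andP=> ?; fin
  | |- is_true (_ == _) -> _ => case/L; rewrite ?level_wpos ?wn ?w0 //;
      try (have E : ambdim Y n = n by apply: ambdim_nonA); lia
  end in fin.
Qed.

End Level.

Section RootMatrixEntries.
Local Open Scope ring_scope.
#[local] Arguments natdim : simpl never.
#[local] Arguments ambdim : simpl never.

Lemma root_mx_support Y n (F : finFieldType) (c : shape (ambdim Y n)) t r s :
  (r, s) \notin support c -> root_mx c t r s = (r == s)%:R :> F.
Proof.
rewrite /root_mx; case: Y c r s => [] [i j|i j|i|i] r s /=;
 rewrite !inE !xpair_eqE !mxE.
all: repeat match goal with |- context [?a && ?b] =>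
  case: (a && b) => //= end.
all: rewrite ?mulr2n ?(addr0, mulr0, subr0, oppr0) //.
Qed.

Lemma root_mx_corner Y n (F : finFieldType) (c : shape (ambdim Y n)) t :
    is_posroot Y c -> (Y = TypeB \/ Y = TypeC -> 2%:R != 0 :> F) ->
  root_mx c t (corner c).1 (corner c).2 = 0 :> F -> t = 0.
Proof.
move=> cP two; rewrite /root_mx !mxE.
case: Y c cP two => [] [i j|i j|i|i] //= cP two;
  rewrite !mxE ?eqxx.
all: rewrite ?wpos_eq ?wneg_eq ?wneg_wpos ?wzero_neq //.
all: try have ij : (i == j) = false by rewrite -val_eqE ltn_eqF.
all: rewrite ?ij /= ?(mulr0, mulr0n, oppr0, addr0, add0r, subr0, mulr1) //.
have two0 : (1%:R + true%:R : F) != 0 by apply: two; left.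
by move/eqP; rewrite mulf_eq0 (negbTE two0) orbF => /eqP.
Qed.

Lemma mulmx_sub1 (R : comNzRingType) N (A B : 'M[R]_N) :
  A *m B - 1%:M = (A - 1%:M) + (B - 1%:M) + (A - 1%:M) *m (B - 1%:M).
Proof.
rewrite mulmxBl !mulmxBr mul1mx !mulmx1.
by apply/matrixP=> i j; rewrite !mxE; ring.
Qed.

Lemma mx_sub1E (R : nzRingType) N (A : 'M[R]_N) r s :
  (A - 1%:M) r s = A r s - (r == s)%:R.
Proof. by rewrite !mxE. Qed.

(** Matrices 1 + A with A of degree at least ht gamma and with no entry in the
    corner of gamma form a group: the product of two such A has degree at least
    2 ht gamma, so it has no entry there either. *)
Lemma root_elt_indep Y n (F : finFieldType) (gamma : posroot Y n) :
    (Y = TypeB \/ Y = TypeC -> 2%:R != 0 :> F) ->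
  exists2 H : {group {'GL_(natdim Y n).+1[F]}},
    forall delta t, delta != gamma -> (ht gamma <= ht delta)%N ->
      root_elt delta t \in H
    & forall t : F, root_elt gamma t \in H -> t = 0.
Proof.
move=> two.
pose bad r s := (level s < level r + ht gamma)%N || ((r, s) == corner (rshape gamma)).
pose K := [set y : {'GL_(natdim Y n).+1[F]} |
  [forall r, forall s, bad r s ==> ((val y - 1%:M) r s == 0)]].
have KP (y : {'GL_(natdim Y n).+1[F]}) :
    reflect (forall r s, bad r s -> (val y - 1%:M) r s = 0) (y \in K).
  rewrite inE; apply: (iffP forallP) => H.
    by move=> r s rs; move/forallP: (H r) => /(_ s)/implyP/(_ rs)/eqP.
  by move=> r; apply/forallP=> s; apply/implyP=> /H->.
have Kg : group_set K.
  apply/group_setP; split.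
    by apply/KP=> r s _; rewrite /= subrr mxE.
  move=> y z /KP yK /KP zK; apply/KP=> r s rs.
  have -> : val (y * z)%g - 1%:M = (val y - 1%:M) + (val z - 1%:M) +
     (val y - 1%:M) *m (val z - 1%:M).
    exact: mulmx_sub1.
  rewrite 2!mxE yK // zK // add0r add0r mxE big1 // => k _.
  have [lt|ge] := ltnP (level k) (level r + ht gamma).
    by rewrite yK ?mul0r // /bad lt.
  rewrite zK ?mulr0 // /bad; apply/orP; left.
  apply: leq_trans (_ : level r + ht gamma + ht gamma <= _)%N; last by rewrite leq_add2r.
  case/orP: rs => [lt|/eqP rs]; first by apply: leq_trans (lt) _; rewrite leq_addr.
  have := corner_level (rshapeP gamma); rewrite -rs /= => ->.
  by rewrite -[X in (X < _)%N]addn0 ltn_add2l ht_gt0.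
exists (Group Kg) => [d t dg le | t].
  apply/KP=> r s rs; rewrite mx_sub1E root_mx_support ?subrr //.
  apply/negP=> sup; case/orP: rs => [|/eqP rs].
    by rewrite ltnNge (leq_trans _ (support_level (rshapeP d) sup)) // leq_add2l.
  case/eqP: dg; apply: val_inj; apply: support_corner (rshapeP _) (rshapeP _) _.
  by rewrite -rs.
move/KP/(_ (corner (rshape gamma)).1 (corner (rshape gamma)).2).
rewrite /bad -surjective_pairing eqxx orbT => /(_ isT).
rewrite mx_sub1E.
have -> : ((corner (rshape gamma)).1 == (corner (rshape gamma)).2) = false.
  apply/eqP=> E; have := corner_level (rshapeP gamma); rewrite E.
  by move: (ht_gt0 gamma); rewrite /ht; lia.
by rewrite subr0; apply: root_mx_corner (rshapeP gamma) two.
Qed.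
End RootMatrixEntries.

(** * The Chevalley root elements *)

Lemma two_neq0_of_card (F : finFieldType) p e :
  prime p -> #|F| = (p ^ e)%N -> (2 < p)%N -> (2%:R != 0 :> F)%R.
Proof.
move=> p_pr Fq p2; have pF := card_finPcharP Fq p_pr.
rewrite -(dvdn_pcharf pF); apply: contraL p2 => /dvdn_leq; rewrite -leqNgt; exact.
Qed.

Lemma root_elt_system Y n (F : finFieldType) :
    (Y = TypeB \/ Y = TypeC -> 2%:R != 0 :> F)%R ->
  root_system_group (@root_elt F Y n).
Proof.
move=> two; split.
- by move=> g t u; apply: val_inj; rewrite /= root_mxD ?rshapeP.
- have A b g d : sum_shape (rshape b) (rshape g) (rshape d) ->
    exists2 c, c != 0%R & comm_form (@root_elt F Y n) b g d c.
    move/(root_comm_sum two (rshapeP b) (rshapeP g) (rshapeP d)).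
    case=> c c0 H; exists c => // t u; have [z zP E] := H t u.
    have [w wz wP] : exists2 w, val w = z & comm_rest (@root_elt F Y n) b g d w.
      case: zP => [->|[d' [d'P S] [s ->]]]; first by exists 1; [|left].
      exists (root_elt (PosRoot d'P) s) => //; right.
      by exists (PosRoot d'P); [case: S => /eqP S; [left | right] | exists s].
    exists w => //; apply: (mulgI (root_elt g u * root_elt b t)).
    rewrite -commgC mulgA.
    by subst z; apply: val_inj; exact: E.
  by move=> b g d /rsum_shape[] /A[c c0 H]; exists c => //; [left | right].
- move=> b g t u H; apply: val_inj.
  have E := root_comm_nosum t u (rshapeP b) (rshapeP g).
  by apply: E => c cP; apply: (H (PosRoot cP)).
- by move=> g; apply: root_elt_indep.
Qed.

(** * Clifford theory *)

Section CliffordTheory.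
Import Order.TTheory Num.Theory.
Local Open Scope ring_scope.
Variable gT : finGroupType.
Implicit Types G H K T U S A B X M : {group gT}.

Lemma sub_cfcenter_irr G H i : H \subset G ->
  (H \subset 'Z('chi[G]_i)%CF) = ([~: H, G]%g \subset cfker 'chi_i).
Proof.
move=> sHG; have [sKG nKG] := andP (cfker_normal 'chi_i).
have nKH := subset_trans sHG nKG.
rewrite -quotient_cents2 //.
have sKZ : cfker 'chi_i \subset 'Z('chi_i)%CF.
  exact: normal_sub (cfker_center_normal _).
rewrite -(quotientSGK nKH sKZ) cfcenter_eq_center /center subsetI quotientS //.
Qed.

Lemma clifford_irr G T H phi : H <| G -> phi \in irr H -> 'I_G[phi] = T ->
  forall psi, psi \in irr T -> '['Res[H] psi, phi] != 0 -> 'Ind[G] psi \in irr G.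
Proof.
move=> nsHG /irrP[t ->] ET psi /irrP[s ->] sT.
have ET' : T = 'I_G['chi_t]%G by apply: val_inj.
subst T; have [H1 _ _ _ _] := constt_Inertia_bijection t nsHG.
by apply: H1; rewrite constt_Ind_Res inE.
Qed.

Lemma clifford_inj G T H phi : H <| G -> phi \in irr H -> 'I_G[phi] = T ->
  forall psi1 psi2, psi1 \in irr T -> psi2 \in irr T ->
    '['Res[H] psi1, phi] != 0 -> '['Res[H] psi2, phi] != 0 ->
    'Ind[G] psi1 = 'Ind[G] psi2 -> psi1 = psi2.
Proof.
move=> nsHG /irrP[t ->] ET _ _ /irrP[s1 ->] /irrP[s2 ->] h1 h2 E.
have ET' : T = 'I_G['chi_t]%G by apply: val_inj.
subst T; have [_ H2 _ _ _] := constt_Inertia_bijection t nsHG.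
congr 'chi__; apply: H2; rewrite ?constt_Ind_Res ?inE //.
by rewrite /Ind_Iirr E.
Qed.

Lemma clifford_onto G T H phi : H <| G -> phi \in irr H -> 'I_G[phi] = T ->
  forall chi, chi \in irr G -> '['Res[H] chi, phi] != 0 ->
    exists2 psi, psi \in irr T /\ '['Res[H] psi, phi] != 0 & chi = 'Ind[G] psi.
Proof.
move=> nsHG /irrP[t ->] ET _ /irrP[r ->] rH.
have ET' : T = 'I_G['chi_t]%G by apply: val_inj.
subst T; have [H1 _ H3 _ _] := constt_Inertia_bijection t nsHG.
have : r \in irr_constt ('Ind[G] 'chi_t) by rewrite constt_Ind_Res inE.
rewrite -H3 => /imsetP[s sT ->]; exists 'chi_s.
  by rewrite mem_irr; move: sT; rewrite constt_Ind_Res inE.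
by rewrite cfIirrE ?H1.
Qed.

(** The conjugates of phi are distinct constituents of the induced character
    when they agree with phi on B.  If there are at least |A : B| of them they
    exhaust it, since the norm of the induced character is |A : B|. *)
Lemma Ind_Res_sum_cfclass U A B phi : A <| U -> B <| A -> phi \is a linear_char ->
    (forall u, u \in U -> 'Res[B] (phi ^ u)%CF = 'Res[B, A] phi) ->
    (#|A : B| <= #|U : 'I_U[phi]|)%N ->
  'Ind[A] ('Res[B] phi) = \sum_(xi <- (phi ^: U)%CF) xi.
Proof.
move=> nsAU nsBA Lphi invB le; have [sBA nBA] := andP nsBA; have [sAU nAU] := andP nsAU.
set beta := 'Res[B] phi; set Th := \sum_(xi <- _) xi.
have Lbeta : beta \is a linear_char by apply: cfRes_lin_char.
have nbeta : '[beta] = 1 by apply/irrWnorm/lin_char_irr.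
have sAI : A \subset 'I[beta].
  apply/subsetP=> a aA; rewrite inE (subsetP nBA) //=.
  rewrite cfConjgRes_norm ?(subsetP nBA) ?(subsetP (normG A)) //.
  by rewrite invB ?(subsetP sAU).
have nInd : '['Ind[A] beta] = #|A : B|%:R.
  rewrite -Frobenius_reciprocity cfRes_Ind_invariant // cfdotZr nbeta mulr1.
  exact: conjC_nat.
have xi_irr xi : xi \in (phi ^: U)%CF -> xi \in irr A.
  by case/cfclassP=> y _ ->; apply: cfConjg_irr; apply: lin_char_irr.
have nTh : '[Th] = #|U : 'I_U[phi]|%:R.
  have [t Et] : exists t, phi = 'chi_t by apply/irrP/lin_char_irr.
  rewrite cfnorm_orthonormal ?Et ?size_cfclass // -Et.
  by apply: sub_orthonormal (irr_orthonormal A); [exact: xi_irr | apply: cfclass_uniq].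
have dInd : '['Ind[A] beta, Th] = #|U : 'I_U[phi]|%:R.
  have [t Et] : exists t, phi = 'chi_t by apply/irrP/lin_char_irr.
  rewrite cfdot_sumr (eq_big_seq (fun=> 1)) => [|xi /cfclassP[y yU ->]]; last first.
    by rewrite -Frobenius_reciprocity invB.
  by rewrite big_const_seq count_predT iter_addr_0 Et size_cfclass.
apply/eqP; rewrite -subr_eq0 -cfnorm_eq0 eq_le cfnorm_ge0 andbT.
rewrite cfnormB nInd nTh dInd conjC_nat opprD addrA addrK subr_le0.
by rewrite ler_nat.
Qed.

(** The abstract form of the correspondence.  In the application U is the full
    group, S = P(source), A = P({alpha} + leg + k), K = P(k), X = X_alpha and
    M = P(source minus alpha). *)
Section ArmLegCorrespondence.
Variables U S A K X M : {group gT}.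
Hypotheses (nAU : A <| U) (sAS : A \subset S) (sSU : S \subset U).
Hypotheses (nKU : K <| U) (sKA : K \subset A) (sKM : K \subset M).
Hypotheses (sXA : X \subset A) (abX : abelian X) (cXU : [~: X, U]%g \subset K).
Hypothesis sdS : (M ><| X = S)%g.
Hypothesis inertiaS : forall lambda, lambda \in irr X -> lambda != 1 ->
  'I_U['Res[A] (cfSdprod sdS lambda)]%g = S.
Hypothesis indexA : (#|A : K <*> X| <= #|U : S|)%N.

Local Notation theta := (cfSdprod sdS).
Local Notation phi lambda := ('Res[A, S] (theta lambda)).

Let sAU : A \subset U := normal_sub nAU.
Let sXU : X \subset U := subset_trans sXA sAU.
Let sXS : X \subset S := subset_trans sXA sAS.
Let nAS : A <| S := normalS sAS sSU nAU.

Let B := (K <*> X)%G.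
Let sBA : B \subset A. Proof. by rewrite join_subG sKA. Qed.
Let sBU : B \subset U := subset_trans sBA sAU.

Let cBUK : [~: B, U]%g \subset K.
Proof.
have nKX := subset_trans sXU (normal_norm nKU).
have nKU' := normal_norm nKU; have nKB := subset_trans sBU nKU'.
by rewrite -quotient_cents2 //= quotientYidl // quotient_cents2.
Qed.

Let nBU : B <| U.
Proof.
rewrite /normal sBU -commg_subl; apply: subset_trans cBUK _; exact: joing_subl.
Qed.

Lemma center_linear lambda : lambda \in irr X -> lambda \is a linear_char.
Proof. by case/irrP=> i ->; apply: char_abelianP. Qed.

Lemma theta_linear lambda : lambda \in irr X -> theta lambda \is a linear_char.
Proof. by move=> /center_linear; rewrite cfSdprod_lin_char. Qed.

Lemma phi_linear lambda : lambda \in irr X -> phi lambda \is a linear_char.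
Proof. by move=> /theta_linear; apply: cfRes_lin_char. Qed.

Lemma phi_irr lambda : lambda \in irr X -> phi lambda \in irr A.
Proof. by move=> /phi_linear; apply: lin_char_irr. Qed.

Lemma phi_centerE lambda : {in X, phi lambda =1 lambda}.
Proof. by move=> y yX; rewrite cfResE ?(subsetP sXA) // cfSdprodEr. Qed.

Lemma phi_kernel lambda y : lambda \in irr X -> y \in K -> phi lambda y = 1.
Proof.
move=> lirr yK; rewrite cfResE ?(subsetP sKA) // cfker1.
  by rewrite lin_char1 ?theta_linear.
by apply: subsetP (cfker_sdprod _ _) _ _; apply: subsetP sKM _ yK.
Qed.

Lemma phi_mul_kernel lambda y k : lambda \in irr X -> y \in A -> k \in K ->
  phi lambda (y * k)%g = phi lambda y.
Proof.
move=> lirr yA kK; have kA := subsetP sKA _ kK.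
by rewrite (lin_charM (phi_linear lirr)) // (phi_kernel lirr kK) mulr1.
Qed.

Lemma Res_over mu lambda : lambda \in irr X ->
  'Res[A] ((mu %% A)%CF * theta lambda) = (mu 1%g) *: phi lambda.
Proof.
move=> lirr; apply/cfun_inP=> y yA; have yS := subsetP sAS _ yA.
rewrite cfResE // cfunE [RHS]cfunE cfResE //; congr (_ * _).
by rewrite cfker1 ?cfMod1 //; apply: subsetP (cfker_mod _ nAS) _ yA.
Qed.

Lemma psi_irr mu lambda : mu \in irr (S / A)%g -> lambda \in irr X ->
  (mu %% A)%CF * theta lambda \in irr S.
Proof.
move=> mirr lirr; rewrite mulrC; apply: mul_lin_irr; first exact: theta_linear.
by rewrite cfMod_irr.
Qed.

Lemma psi_over mu lambda : mu \in irr (S / A)%g -> lambda \in irr X ->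
  '['Res[A] ((mu %% A)%CF * theta lambda), phi lambda] != 0.
Proof.
move=> mirr lirr; rewrite Res_over // cfdotZl irrWnorm ?phi_irr // mulr1.
by case/irrP: mirr => i ->; apply: irr1_neq0.
Qed.

Lemma psi_kernel mu lambda : K \subset cfker ((mu %% A)%CF * theta lambda).
Proof.
apply: subset_trans (cfker_mul _ _); rewrite subsetI.
rewrite (subset_trans sKA) ?cfker_mod //.
by rewrite (subset_trans sKM) ?cfker_sdprod.
Qed.

Lemma psi_center_nontrivial mu lambda :
    mu \in irr (S / A)%g -> lambda \in irr X -> lambda != 1 ->
  ~~ (X \subset cfker ((mu %% A)%CF * theta lambda)).
Proof.
move=> mirr lirr; apply: contra => /subsetP sX; apply/eqP/cfun_inP=> y yX.
have := cfker1 (sX _ yX); rewrite !cfunE cfMod1 cfSdprodEr // cfSdprod1.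
rewrite (lin_char1 (center_linear lirr)) mulr1.
rewrite [(mu %% A)%CF y]cfker1 ?cfMod1; last first.
  by apply: subsetP (cfker_mod _ nAS) _ _; apply: subsetP sXA _ yX.
have mu1 : mu 1%g != 0 by case/irrP: mirr => i ->; apply: irr1_neq0.
by rewrite -{2}[mu 1%g]mulr1 => /(mulfI mu1)->; rewrite cfun1E yX.
Qed.

Lemma central_linear chi : chi \in irr U -> K \subset cfker chi ->
  exists2 xi : 'CF(B), xi \is a linear_char & 'Res[B] chi = chi 1%g *: xi.
Proof.
case/irrP=> i -> Kchi; have sBZ : B \subset 'Z('chi_i)%CF.
  by rewrite sub_cfcenter_irr // (subset_trans cBUK).
have [xi Lxi E] := cfcenter_Res 'chi_i.
exists ('Res[B] xi); first exact: cfRes_lin_char.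
by rewrite -(cfResRes _ sBZ (cfcenter_sub _)) E linearZ.
Qed.

(** As K X is central modulo K, the restriction to K X of an irreducible character
    trivial on K is a multiple of a linear character, determined by its values
    on X. *)
Lemma central_phi chi : chi \in irr U -> K \subset cfker chi ->
  exists2 lambda, lambda \in irr X & 'Res[B] chi = chi 1%g *: 'Res[B] (phi lambda).
Proof.
move=> chiirr Kchi; have [xi Lxi E] := central_linear chiirr Kchi.
have sXB : X \subset B by apply: joing_subr.
have lirr : 'Res[X] xi \in irr X by apply/lin_char_irr/cfRes_lin_char.
exists ('Res[X] xi) => //; rewrite E; congr (_ *: _); apply/cfun_inP=> b bB.
have chi1 : chi 1%g != 0 by case/irrP: chiirr => i ->; apply: irr1_neq0.
have: b \in (K * X)%g.
  by rewrite -norm_joinEr // (subset_trans sXU) ?normal_norm.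
case/mulsgP=> k y kK yX Eb; rewrite cfResE // Eb.
have kB : k \in B by apply: subsetP (joing_subl _ _) _ kK.
have yB := subsetP sXB _ yX; have yA := subsetP sXA _ yX.
have kA := subsetP sKA _ kK.
rewrite (lin_charM Lxi) //.
rewrite (lin_charM (phi_linear lirr)) //.
rewrite (phi_kernel lirr kK) mul1r.
rewrite phi_centerE // cfResE //.
have: chi k = chi 1%g * xi k by rewrite -(cfResE chi sBU kB) E cfunE.
rewrite cfker1 ?(subsetP Kchi) // -{1}[chi 1%g]mulr1 => /(mulfI chi1)<-.
by rewrite mul1r.
Qed.

Lemma phi_conj_central lambda u : lambda \in irr X -> u \in U ->
  'Res[B] (phi lambda ^ u)%CF = 'Res[B] (phi lambda).
Proof.
move=> lirr uU; apply/cfun_inP=> b bB; rewrite !(cfResE _ sBA) //.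
rewrite cfConjgE ?(subsetP (normal_norm nAU)) // conjg_mulR phi_mul_kernel //.
  exact: subsetP sBA _ bB.
by apply: subsetP cBUK _ _; rewrite mem_commg ?groupV.
Qed.

(** Since the conjugates of phi are all the characters of A that lie above its
    restriction to K X, one of them, hence phi, occurs in chi. *)
Lemma phi_over chi lambda : chi \in irr U -> lambda \in irr X -> lambda != 1 ->
    'Res[B] chi = chi 1%g *: 'Res[B] (phi lambda) ->
  '['Res[A] chi, phi lambda] != 0.
Proof.
move=> chiirr lirr l1 E.
have chi1 : chi 1%g != 0 by case/irrP: chiirr => i ->; apply: irr1_neq0.
have nBA : B <| A by apply: normalS nBU.
have Ls : 'Res[B] (phi lambda) \is a linear_char by apply/cfRes_lin_char/phi_linear.
have: '['Ind[A] ('Res[B] (phi lambda)), 'Res[A] chi] != 0.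
  rewrite -Frobenius_reciprocity [X in '[_, X]]cfResRes // E cfdotZr.
  rewrite irrWnorm ?lin_char_irr //.
  by rewrite mulr1 conjC_eq0.
rewrite (Ind_Res_sum_cfclass nAU nBA (phi_linear lirr)) ?inertiaS //; last first.
  by move=> u uU; apply: phi_conj_central.
apply: contraNneq => chi0; rewrite cfdot_suml big_seq big1 // => xi.
case/cfclassP=> u uU ->; rewrite cfdotC cfdot_Res_conjg // chi0.
by rewrite conjC0.
Qed.

Lemma Ind_psi_centerE mu lambda y : mu \in irr (S / A)%g -> lambda \in irr X -> y \in X ->
  'Ind[U] ((mu %% A)%CF * theta lambda) y =
  'Ind[U] ((mu %% A)%CF * theta lambda) 1%g * lambda y.
Proof.
move=> mirr lirr yX; have yS := subsetP sXS _ yX.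
rewrite !cfIndE // -mulrA mulr_suml; congr (_ * _); apply: eq_bigr => u uU.
rewrite conj1g conjg_mulR cfkerMr; last first.
  by apply: subsetP (psi_kernel mu lambda) _ _; apply: subsetP cXU _ _; apply: mem_commg.
rewrite !cfunE cfSdprodEr // (lin_char1 (theta_linear lirr)) mulr1; congr (_ * _).
by rewrite cfker1 //; apply: subsetP (cfker_mod _ nAS) _ _; apply: subsetP sXA _ yX.
Qed.

Lemma arm_leg_correspondence :
  bijection_on
    [pred ml : 'CF(S / A)%g * 'CF(X) |
       [&& ml.1 \in irr (S / A)%g, ml.2 \in irr X & ml.2 != 1]]
    [pred chi : 'CF(U) |
       [&& chi \in irr U, K \subset cfker chi & ~~ (X \subset cfker chi)]]
    (fun ml => 'Ind[U] ((ml.1 %% A)%CF * theta ml.2)).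
Proof.
split=> [[mu lambda] /and3P[/= mirr lirr l1]
       | [mu lambda] [mu' lambda'] /and3P[/= mirr lirr l1] /and3P[/= mirr' lirr' l1'] /= E
       | chi /and3P[chiirr Kchi Xchi]].
- have irrI : 'Ind[U] ((mu %% A)%CF * theta lambda) \in irr U.
    apply: (clifford_irr nAU (phi_irr lirr) (inertiaS lirr l1)).
      exact: psi_irr.
    exact: psi_over.
  rewrite inE irrI /=; have [s Es] : exists s, (mu %% A)%CF * theta lambda = 'chi_s.
    by apply/irrP/psi_irr.
  rewrite Es cfker_Ind_irr // -Es sub_gcore ?normal_norm // psi_kernel /=.
  apply: contra (psi_center_nontrivial mirr lirr l1) => /subset_trans; apply.
  exact: gcore_sub.
- have over1 := psi_over mirr lirr; have over2 := psi_over mirr' lirr'.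
  have El : lambda = lambda'.
    apply/cfun_inP=> y yX; have := Ind_psi_centerE mirr lirr yX.
    rewrite E (Ind_psi_centerE mirr' lirr' yX) => /mulfI-> //.
    rewrite -E; have := clifford_irr nAU (phi_irr lirr) (inertiaS lirr l1)
      (psi_irr mirr lirr) over1.
    by case/irrP=> i ->; apply: irr1_neq0.
  subst lambda'; congr (_, _).
  have := clifford_inj nAU (phi_irr lirr) (inertiaS lirr l1)
    (psi_irr mirr lirr) (psi_irr mirr' lirr) over1 over2 E.
  by move/(mulIr (lin_char_unitr (theta_linear lirr)))/(can_inj (cfModK nAS)).
have [lambda lirr E] := central_phi chiirr Kchi.
have l1 : lambda != 1.
  apply: contraNneq Xchi => El; apply/subsetP=> y yX.
  have yB : y \in B by apply: subsetP (joing_subr _ _) _ yX.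
  have := congr1 (fun f : 'CF(B) => f y) E.
  rewrite El cfunE !cfResE ?(subsetP sXA) //.
  rewrite cfSdprodEr // cfun1E yX mulr1; case/irrP: chiirr => i -> Ei.
  by rewrite cfkerEirr inE Ei.
have over := phi_over chiirr lirr l1 E.
have IS := inertiaS lirr l1.
have [psi [psiirr psio] ->] := clifford_onto nAU (phi_irr lirr) IS chiirr over.
have Lth := theta_linear lirr; have Lthc : (theta lambda)^*%CF \is a linear_char.
  by rewrite cfConjC_lin_char.
have ResA : 'Res[A] psi = psi 1%g *: phi lambda.
  have [t Et] : exists t, phi lambda = 'chi_t by apply/irrP/phi_irr.
  have [s Es] : exists s, psi = 'chi_s by apply/irrP.
  have st : t \in irr_constt ('Res[A] 'chi_s) by rewrite inE -Es -Et.
  have := Clifford_Res_sum_cfclass nAS st.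
  rewrite cfclass_invariant; last by rewrite -Et -{1}IS subsetIr.
  rewrite big_seq1 -Es -Et; move: '[_, _] => c Ec.
  have := congr1 (fun f : 'CF(A) => f 1%g) Ec.
  by rewrite cfRes1 cfunE (lin_char1 (phi_linear lirr)) mulr1 => ->.
have normth y : y \in S -> theta lambda y * (theta lambda y)^* = 1.
  by move=> yS; rewrite -normCK (normC_lin_char Lth yS) expr1n.
have psi'irr : psi * (theta lambda)^*%CF \in irr S.
  by rewrite mulrC; apply: mul_lin_irr.
(* psi and theta restrict to multiples of the same linear character of A *)
have kerA : A \subset cfker (psi * (theta lambda)^*%CF).
  apply/subsetP=> y yA; have yS := subsetP sAS _ yA.
  case/irrP: psi'irr => i Ei; rewrite Ei cfkerEirr inE -Ei !cfunE.
  have := congr1 (fun f : 'CF(A) => f y) ResA.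
  rewrite cfunE !cfResE // => ->; rewrite -mulrA normth //.
  by rewrite (lin_char1 Lth) rmorph1.
exists ((psi * (theta lambda)^*%CF / A)%CF, lambda).
  by rewrite inE /= cfQuo_irr // psi'irr lirr l1.
rewrite /= cfQuoK //; congr ('Ind[U] _); apply/cfun_inP=> y yS.
by rewrite !cfunE -mulrA [X in _ * X]mulrC normth // mulr1.
Qed.

End ArmLegCorrespondence.
End CliffordTheory.

(** * Root supports and the inertia group *)

Section ArmLegGroups.
Local Open Scope ring_scope.
Local Open Scope group_scope.
Variables (Y : dynkin) (n : nat) (F : finFieldType) (gT : finGroupType).
Variables (x : posroot Y n -> F -> gT) (xP : root_system_group x).
Local Notation root := (posroot Y n).
Implicit Types (alpha beta gamma delta : root) (N Q R : {set root}) (t u v : F).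
Local Notation P := (pattern x).
Local Notation X := (root_group x).

Definition higher gamma : {set root} := [set delta : root | (ht gamma < ht delta)%N].

Lemma higher_normal gamma : normal_pattern (higher gamma) setT.
Proof.
apply/normal_patternP; split=> [|b c d]; first exact: subsetT.
by rewrite !inE => lt _ /htD->; rewrite (leq_trans lt) ?leq_addr.
Qed.

Lemma higher_kset alpha : higher alpha \subset kset alpha.
Proof.
apply/subsetP=> d; rewrite inE => lt; apply: kset_ht; first exact: ltnW.
by apply: contraTneq lt => ->; rewrite ltnn.
Qed.

Lemma root_groupT_comm gamma Q : normal_pattern Q setT ->
  (forall beta delta, rsum gamma beta delta -> delta \in Q) ->
  [~: X gamma, P setT] \subset P Q.
Proof.
move=> nQ H; apply: subset_trans (commSg _ (rootg_pattern x (set11 gamma))) _.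
apply: (pattern_commg xP nQ) => // b g d /set1P-> _; exact: H.
Qed.

Lemma root_central alpha : [~: X alpha, P setT] \subset P (kset alpha).
Proof.
apply: root_groupT_comm (kset_normal alpha) _ => b d abd; apply: kset_ht.
  by rewrite (htD abd) leq_addr.
by have /andP[_] := rsum_neq abd; rewrite eq_sym.
Qed.

Lemma sub_cfker_pattern (N : {group gT}) Q :
  (forall gamma, gamma \in Q -> X gamma \subset N) -> P Q \subset N.
Proof. by move=> H; apply: pattern_subG => g t /H/subsetP; apply; apply: mem_rootg. Qed.

(** A root of k(alpha) of maximal height among those outside the kernel would be
    central modulo the kernel, hence in the root support. *)
Lemma kset_cfker alpha (chi : 'CF(P setT)) : chi \in irr (P setT) ->
    (forall gamma, X gamma \subset 'Z(chi)%CF -> ~~ (X gamma \subset cfker chi) ->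
       gamma = alpha) ->
  P (kset alpha) \subset cfker chi.
Proof.
move=> /irrP[i Ei] rs; subst chi; apply: sub_cfker_pattern => g0 g0k.
apply/negPn/negP=> g0K.
pose bad g := (g \in kset alpha) && ~~ (X g \subset cfker 'chi_i).
have bad0 : bad g0 by rewrite /bad g0k.
case: (@arg_maxnP _ g0 bad (fun g => ht g) bad0) => g /andP[gk gK] gmax.
have sXU : rootG xP g \subset P setT by apply/rootg_pattern/in_setT.
suff gZ : rootG xP g \subset 'Z('chi_i)%CF.
  by case/negP: (notin_kset alpha); rewrite -{1}(rs g gZ gK).
rewrite sub_cfcenter_irr //.
pose Q := kset alpha :&: higher g.
apply: (@subset_trans _ _ (P Q)).
  apply: root_groupT_comm => [|b d gbd]; last first.
    by rewrite in_setI (kset_sum gk gbd) inE (htD gbd) -addn1 leq_add2l ht_gt0.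
  apply/normal_patternP; split=> [|b c d]; first exact: subsetT.
  rewrite !in_setI => /andP[bk bh] _ bcd; rewrite (kset_sum bk bcd) /=.
  move: bh; rewrite !inE => bh; rewrite (htD bcd) (leq_trans bh) ?leq_addr //.
apply: sub_cfker_pattern => d /setIP[dk dh]; apply/negPn/negP=> dK.
have bd : bad d by rewrite /bad dk.
by have := leq_ltn_trans (gmax d bd); rewrite inE in dh => /(_ _ dh); rewrite ltnn.
Qed.

(** A normal subgroup that contains elements with arbitrary leading term at delta
    also does at any root reached from delta: take commutators with the root
    elements that are added, and normalise the coefficient. *)
Lemma leading_in_normal (N : {group gT}) alpha delta : P setT \subset 'N(N) ->
    below alpha delta ->
    (forall t, exists2 j, j \in P (higher delta) & x delta t * j \in N) ->
  forall t, exists2 j, j \in P (higher alpha) & x alpha t * j \in N.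
Proof.
move=> nN; elim=> // g b d gbd _ IH Hg; apply: IH => t.
have hd d' : (ht d < ht d')%N -> d' \in higher d by rewrite inE.
have [c c0 H] := leading_comm xP gbd (higher_normal d) hd.
have [j jh jN] := Hg 1%R.
have [z zh E] := H 1%R (t / c)%R.
have bU u : x b u \in P setT by apply/mem_pattern/in_setT.
have dU u : x d u \in P setT by apply/mem_pattern/in_setT.
have jU : j \in P setT by apply: subsetP (patternS x (subsetT _)) _ jh.
have nH : P setT \subset 'N(P (higher d)).
  by apply: pattern_norm => //; apply: higher_normal.
have Ec : (c * (1 * (t / c)) = t)%R by rewrite mul1r mulrCA mulfV ?mulr1.
have := commMgJ (x g 1%R) j (x b (t / c)%R).
rewrite E Ec conjMg conjg_mulR => Ej.
have zj : z ^ j \in P (higher d) by rewrite memJ_norm // (subsetP nH).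
have cj b' u : (forall g' d', g' \in higher g -> rsum g' b' d' -> d' \in higher d) ->
    [~ j, x b' u] \in P (higher d).
  move=> HQ; have: [~: P (higher g), P [set b']] \subset P (higher d).
    apply: (pattern_commg xP (higher_normal d)); rewrite ?subsetT //.
    by move=> g' b'' d' g'Q /set1P->; apply: HQ.
  by move/subsetP; apply; apply: mem_commg => //; apply/mem_pattern/set11.
have c1 : [~ x d t, j] \in P (higher d).
  rewrite -groupV invg_comm; apply: cj => g' d' _; rewrite inE => /htD->.
  by rewrite -[X in (X < _)%N]add0n ltn_add2r ht_gt0.
have c2 : [~ j, x b (t / c)%R] \in P (higher d).
  apply: cj => g' d'; rewrite !inE => lt /htD->.
  by rewrite (htD gbd) ltn_add2r.
have commN : [~ x g 1%R * j, x b (t / c)%R] \in N.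
  apply: subsetP (_ : [~: N, P setT] \subset N) _ _; first by rewrite commg_subl.
  exact: mem_commg.
move: [~ x d t, j] (z ^ j) [~ j, _] c1 zj c2 Ej => y1 y2 y3 y1h y2h y3h Ej.
exists (y1 * y2 * y3); first by rewrite !groupM.
by rewrite !mulgA -Ej.
Qed.

(** If gamma <> alpha is another such root then alpha is reached from it in at
    least one step; the commutators of X_gamma lie in the kernel, so the first
    step produces leading terms in the kernel, and these climb up to alpha. *)
Lemma root_support_unique alpha gamma (chi : 'CF(P setT)) : chi \in irr (P setT) ->
    P (kset alpha) \subset cfker chi -> ~~ (X alpha \subset cfker chi) ->
    X gamma \subset 'Z(chi)%CF -> ~~ (X gamma \subset cfker chi) ->
  gamma = alpha.
Proof.
move=> /irrP[i Ei] sK aK gZ gK; subst chi.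
have [gk|gk] := boolP (gamma \in kset alpha).
  by case/negP: gK; apply: subset_trans sK; apply: rootg_pattern.
have sXU : rootG xP gamma \subset P setT by apply/rootg_pattern/in_setT.
have gU : [~: X gamma, P setT] \subset cfker 'chi_i.
  by move: gZ; rewrite -[X gamma]/(gval (rootG xP gamma)) sub_cfcenter_irr.
have nN := cfker_norm 'chi_i.
case: (kset_below gk) aK gU => // g b d gbd ad /negP aK gU.
case: aK; have hd d' : (ht d < ht d')%N -> d' \in higher d by rewrite inE.
have [c c0 H] := leading_comm xP gbd (higher_normal d) hd.
have dN : forall t, exists2 j, j \in P (higher d) & x d t * j \in cfker 'chi_i.
  move=> t; have [z zh E] := H 1%R (t / c)%R; exists z => //.
  have -> : x d t * z = [~ x g 1%R, x b (t / c)%R].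
    by rewrite E mul1r mulrCA mulfV ?mulr1.
  apply: subsetP gU _ _; apply: mem_commg; first exact: mem_rootg.
  by apply/mem_pattern/in_setT.
apply/subsetP=> _ /rootgP[t ->].
have [j jh] := leading_in_normal nN ad dN t.
rewrite groupMr //; apply: subsetP sK _ _.
by apply: subsetP (patternS x (higher_kset alpha)) _ jh.
Qed.

Lemma irr_rootP alpha (chi : 'CF(P setT)) : chi \in irr (P setT) ->
  ([set gamma | (X gamma \subset 'Z(chi)%CF) && ~~ (X gamma \subset cfker chi)]
     == [set alpha]) =
  (P (kset alpha) \subset cfker chi) && ~~ (X alpha \subset cfker chi).
Proof.
move=> chiirr; apply/eqP/andP=> [rs | [sK aK]].
  have aR : alpha \in [set alpha] by rewrite set11.
  move: (aR); rewrite -{1}rs inE => /andP[aZ aK]; split=> //.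
  apply: kset_cfker => // g gZ gK; apply/set1P; rewrite -rs inE gZ gK //.
apply/setP=> g; rewrite inE in_set1; apply/andP/eqP=> [[gZ gK]|->].
  exact: root_support_unique gZ gK.
split=> //; have sXU : rootG xP alpha \subset P setT by apply/rootg_pattern/in_setT.
case/irrP: chiirr sK => i -> sK; rewrite -[X alpha]/(gval (rootG xP alpha)).
by rewrite sub_cfcenter_irr //; apply: subset_trans sK; apply: root_central.
Qed.

Section Inertia.
Variable alpha : root.
Local Notation S := (source alpha).
Local Notation L := (leg alpha :|: kset alpha).
Local Notation H := (alpha |: leg alpha :|: kset alpha).

Lemma legk_hookk : L \subset H.
Proof. by rewrite -setUA subsetUr. Qed.

Lemma hookk_source : H \subset S.
Proof.
apply/subsetP=> g /setUP[/setU1P[->|]|]; first exact: root_source.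
  exact: leg_source.
exact: kset_source.
Qed.

Lemma comm_hook_source : [~: P H, P S] \subset P L.
Proof.
apply: (pattern_commg xP (legk_normal alpha)) (subxx _) _; first exact: hookk_source.
move=> b g d; rewrite -setUA => /setU1P[->|bL] gS bgd.
  rewrite in_setU kset_ht ?orbT //; first by rewrite (htD bgd) leq_addr.
  by have /andP[_] := rsum_neq bgd; rewrite eq_sym.
have [_ HL] := normal_patternP _ _ (legk_normal alpha).
exact: HL bL gS bgd.
Qed.

Variable phi : 'CF(P H).
Hypotheses (Lphi : phi \is a linear_char) (phiL : {in P L, forall y, phi y = 1%R}).

Let sLH : P L \subset P H := patternS x legk_hookk.

Lemma source_inertia : P S \subset 'I_(P setT)[phi].
Proof.
have sSU : P S \subset P setT := patternS x (subsetT _).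
have nHU : P setT \subset 'N(P H) := pattern_norm xP (hookk_normal alpha).
rewrite subsetI sSU; apply/subsetP=> s sS; have sU := subsetP sSU _ sS.
rewrite inE (subsetP nHU) //=; apply/eqP/cfun_inP=> y yH.
rewrite cfConjgE ?(subsetP nHU) // conjg_mulR.
have cL : [~ y, s^-1] \in P L.
  by apply: subsetP comm_hook_source _ _; rewrite mem_commg ?groupV.
have cH := subsetP sLH _ cL.
by rewrite (lin_charM Lphi) // (phiL cL) mulr1.
Qed.

(** Let beta be an arm root of minimal height in R, and gamma = alpha - beta.
    For the other arm roots delta of R, gamma + delta has at least the height of
    alpha, so it lies in k(alpha) if it is a root.  Hence only the factor
    x_beta(t) of an element of P(R) can move phi on X_gamma, and it does unless
    t = 0. *)
Lemma inertia_step R beta : closed_pattern R -> S \subset R -> beta \in R ->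
    beta \in arm alpha ->
    (forall delta, delta \in R -> delta \in arm alpha -> (ht beta <= ht delta)%N) ->
    ~~ [forall t, phi (x alpha t) == 1%R] ->
    'I_(P setT)[phi] \subset P R ->
  closed_pattern (R :\ beta) /\ 'I_(P setT)[phi] \subset P (R :\ beta).
Proof.
move=> cR sSR bR bA bmin phiX sIR.
have nR : normal_pattern (R :\ beta) R.
  apply/normal_patternP; split; first exact: subD1set.
  move=> c d e /setD1P[cb cR'] dR cde.
  rewrite in_setD1 (closed_patternP _ cR _ _ _ cR' dR cde) andbT.
  apply/eqP=> E; subst e.
  have [cA|cA] := boolP (c \in arm alpha).
    have := bmin _ cR' cA.
    by rewrite (htD cde) -[X in (_ <= X)%N]addn0 leq_add2l leqNgt ht_gt0.
  have [dA|dA] := boolP (d \in arm alpha).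
    have := bmin _ dR dA.
    by rewrite (htD cde) -[X in (_ <= X)%N]add0n leq_add2r leqNgt ht_gt0.
  have := closed_patternP _ (source_closed alpha) _ _ _ _ _ cde.
  by rewrite !sourceE => /(_ cA dA); rewrite bA.
split; first exact: normal_closed nR.
have [g bga] := arm_hook bA; have gL : g \in leg alpha by apply/legP; exists beta.
pose Q := kset alpha :|: [set d in leg alpha | (ht g < ht d)%N].
have sQL : Q \subset L.
  apply/subsetP=> d /setUP[dk|]; first by rewrite in_setU dk orbT.
  by rewrite inE => /andP[dL _]; rewrite in_setU dL.
have sLR : L \subset R by apply: subset_trans (subset_trans legk_hookk hookk_source) sSR.
have Qsum c d e : (ht g <= ht c)%N -> c \in leg alpha -> rsum c d e ->
    e != alpha -> e \in Q.
  move=> gc cL cde ea; rewrite in_setU; have [//|ek] := boolP (e \in kset alpha).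
  case: (legk_normalT cL cde ek) => [E|eL]; first by rewrite E eqxx in ea.
  by rewrite inE eL (htD cde) (leq_ltn_trans gc) // -addn1 leq_add2l ht_gt0.
have nQ : normal_pattern Q R.
  apply/normal_patternP; split=> [|c d e]; first exact: subset_trans sQL sLR.
  case/setUP=> [ck|]; first by move=> _ /(kset_sum ck) ek; rewrite in_setU ek.
  rewrite inE => /andP[cL gc] dR cde; apply: (Qsum c d e (ltnW gc) cL cde).
  apply/eqP=> E; subst e.
  have dA : d \in arm alpha.
    case/orP: (arm_leg_rsum cde) => /and3P[] //.
    by rewrite (negbTE (leg_notin_arm cL)).
  have := bmin _ dR dA; rewrite -(leq_add2r (ht g)) -(htD bga) (htD cde) addnC leq_add2l.
  by rewrite leqNgt gc.
have comm_gR : [~: X g, P (R :\ beta)] \subset P Q.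
  apply: subset_trans (commSg _ (rootg_pattern x (set11 g))) _.
  apply: (pattern_commg xP nQ); rewrite ?subD1set ?sub1set ?(subsetP sLR) ?in_setU ?gL //.
  move=> c d e /set1P-> /setD1P[db dR] gde; apply: (Qsum g d e (leqnn _) gL gde).
  apply: contraNneq db => E; subst e; apply/eqP/rvec_inj.
  by move: gde bga; rewrite rsumC /rsum => /eqP-> /eqP/addIr.
have nQR : P R \subset 'N(P Q) := pattern_norm xP nQ.
apply/subsetP=> u uI; have uR := subsetP sIR _ uI.
move: (uR); rewrite -(pattern_mul xP bR nR) => /mulsgP[y _ yR /rootgP[t ->] Eu].
have [t0|tn0] := eqVneq t 0%R; first by rewrite Eu t0 (rsg0 xP) mulg1.
case/negP: phiX; apply/forallP=> s.
have hk d : (ht alpha < ht d)%N -> d \in kset alpha.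
  by move=> lt; apply: subsetP (higher_kset alpha) _ _; rewrite inE.
have gba : rsum g beta alpha by rewrite rsumC.
have [c c0 Hc] := leading_comm xP gba (kset_normal alpha) hk.
(* this v makes the commutator of x_gamma(v) and x_beta(t) start with x_alpha(s) *)
pose v := (s / (c * t))%R.
have [z zk Ez] := Hc v t.
have Ev : (c * (v * t) = s)%R.
  by rewrite /v [(_ / _ * t)%R]mulrC mulrA mulrCA mulfV ?mulr1 // mulf_neq0.
have xgL : x g v \in P L by apply/mem_pattern; rewrite in_setU gL.
have xgH := subsetP sLH _ xgL.
have q1 : [~ x g v, y] \in P Q.
  by apply: subsetP comm_gR _ _; apply: mem_commg => //; apply: mem_rootg.
have bN : x beta t \in 'N(P Q) by apply: subsetP nQR _ _; apply: mem_pattern.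
have q2 : [~ x g v, y] ^ x beta t \in P Q by rewrite memJ_norm.
have uI' : u \in 'I[phi] by case/setIP: uI.
have := inertia_valJ (x g v) uI'.
rewrite Eu conjgM [x g v ^ y]conjg_mulR conjMg [x g v ^ _]conjg_mulR Ez Ev.
have aH : x alpha s \in P H by apply/mem_pattern; rewrite -setUA setU11.
have zL : z \in P L by apply: subsetP (patternS x _) _ zk; apply: subsetUr.
have q2L : [~ x g v, y] ^ x beta t \in P L by apply: subsetP (patternS x sQL) _ q2.
move: ([~ x g v, y] ^ x beta t) q2L => w wL.
have [zH wH] := (subsetP sLH _ zL, subsetP sLH _ wL).
rewrite !(lin_charM Lphi) ?groupM // (phiL xgL) (phiL zL) (phiL wL).
rewrite mul1r !mulr1 => ->.
by rewrite eqxx.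
Qed.

(** Remove the arm roots from Phi+ one by one, in the order of their heights. *)
Lemma inertia_source : ~~ [forall t, phi (x alpha t) == 1%R] ->
  'I_(P setT)[phi] = P S.
Proof.
move=> phiX; apply/eqP; rewrite eqEsubset source_inertia andbT.
suff Hind k R : #|R| = k -> closed_pattern R -> S \subset R ->
    'I_(P setT)[phi] \subset P R -> 'I_(P setT)[phi] \subset P S.
  apply: (Hind _ setT erefl); rewrite ?subsetT ?subsetIl //.
  by apply/closed_patternP=> *; rewrite inE.
elim: k R => [|k IH] R Rk cR sSR sIR.
  by rewrite (cards0_eq Rk) in sSR sIR *; apply: subset_trans sIR (patternS x (sub0set _)).
have [sRS|] := boolP (R \subset S); first exact: subset_trans sIR (patternS x sRS).
case/subsetPn=> b0 b0R b0S; rewrite sourceE negbK in b0S.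
pose RA := [pred b | (b \in R) && (b \in arm alpha)].
have b0RA : RA b0 by rewrite /= b0R.
case: (@arg_minnP _ b0 RA (fun g => ht g) b0RA) => b /andP[bR bA] bmin.
have [|cR' sI'] := inertia_step cR sSR bR bA _ phiX sIR.
  by move=> d dR dA; apply: bmin; rewrite /= dR.
apply: IH cR' _ sI'; first by move: Rk; rewrite (cardsD1 b) bR => -[].
by rewrite subsetD1 sSR sourceE bA.
Qed.
End Inertia.

Lemma root_join_kset alpha : P (kset alpha) <*> X alpha = P (alpha |: kset alpha).
Proof.
apply/eqP; rewrite eqEsubset join_subG patternS ?subsetUr //=.
rewrite rootg_pattern ?setU11 //=; apply: pattern_subG => g t /setU1P[->|gk].
  by apply: subsetP (joing_subr _ _) _ _; apply: mem_rootg.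
by apply: subsetP (joing_subl _ _) _ _; apply: mem_pattern.
Qed.

Lemma root_kset_normal alpha : normal_pattern (alpha |: kset alpha) setT.
Proof.
apply/normal_patternP; split=> [|b g d]; first exact: subsetT.
case/setU1P=> [->|bk] _ bgd; apply/setU1P; right; last exact: kset_sum bk bgd.
apply: kset_ht; first by rewrite (htD bgd) leq_addr.
by have /andP[_] := rsum_neq bgd; rewrite eq_sym.
Qed.

Lemma card_index_pattern N Q : closed_pattern Q -> closed_pattern N -> N \subset Q ->
  #|P Q : P N| = (#|F| ^ #|Q :\: N|)%N.
Proof.
move=> cQ cN sNQ; apply/eqP; have q0 : (0 < #|F|)%N := ltnW (finNzRing_gt1 F).
have := Lagrange (patternS x sNQ); rewrite !(card_pattern xP) //.
rewrite -(cardsID N Q) (setIidPr sNQ) expnD => /eqP.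
by rewrite eqn_pmul2l // expn_gt0 q0.
Qed.

(** Both indices are powers of q, with the sizes of the leg and of the arm as
    exponents. *)
Lemma arm_leg_index alpha :
  #|P (alpha |: leg alpha :|: kset alpha) : P (kset alpha) <*> X alpha| =
  #|P setT : P (source alpha)|.
Proof.
rewrite root_join_kset !card_index_pattern ?source_closed ?subsetT //; last 4 first.
- by apply/closed_patternP=> *; rewrite inE.
- exact: normal_closed (hookk_normal _).
- exact: normal_closed (root_kset_normal _).
- by apply/subsetP=> g; rewrite !in_setU => /orP[->|->]; rewrite ?orbT.
congr (_ ^ _)%N; have [_ _ _ E _] := arm_is_arm_leg alpha.
rewrite setTD setCK E; apply: eq_card => g; rewrite in_setD !in_setU in_set1.
have [gL|gL] := boolP (g \in leg alpha); last first.
  by case: (g == alpha); case: (g \in kset alpha).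
rewrite (negbTE (leg_notin_kset gL)) orbT orbF andbT.
case/legP: gL => b _ /rsum_neq/andP[ga _]; exact: ga.
Qed.

End ArmLegGroups.

(** * The correspondence for UY *)

Lemma eq_bijection_on (aT rT : eqType) (A A' : {pred aT}) (B B' : {pred rT})
    (f f' : aT -> rT) :
  A =i A' -> B =i B' -> f =1 f' -> bijection_on A B f -> bijection_on A' B' f'.
Proof.
move=> eA eB ef [homo inj onto]; split=> [a | a b | y].
- by rewrite -eA -eB -ef; apply: homo.
- by rewrite -!eA -!ef; apply: inj.
by rewrite -eB => /onto[a aA <-]; exists a; rewrite -?eA.
Qed.

(** The proof of the decomposition chosen by the definition is not the given one,
    hence the existential statement. *)
Lemma infl_rootE (F : finFieldType) Y n (alpha : posroot Y n) :
    (Skernel F alpha ><| root_subgroup F alpha = Sgroup F alpha)%g ->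
  exists sdS : (Skernel F alpha ><| root_subgroup F alpha = Sgroup F alpha)%g,
    forall lambda, infl_root lambda = cfSdprod sdS lambda.
Proof.
by rewrite /infl_root => sd; case: eqP => // sdS; exists sdS.
Qed.

Lemma Psi_bijection Y n (F : finFieldType) (alpha : posroot Y n) :
    (Y = TypeB \/ Y = TypeC -> 2%:R != 0 :> F)%R ->
  bijection_on (@irr_domain F Y n alpha) (@irr_root F Y n alpha) (@Psi F Y n alpha).
Proof.
move=> two; have xP := root_elt_system n two.
have [sdS inflE] : exists sdS :
      (Skernel F alpha ><| root_subgroup F alpha = Sgroup F alpha)%g,
    forall lambda, infl_root lambda = cfSdprod sdS lambda.
  apply: infl_rootE.
  exact: (pattern_sdprod xP (source_closed alpha) (root_source alpha)
           (source_minus_normal alpha)).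
have nAU : Tkernel F alpha <| UY F Y n := pattern_normal xP (hookk_normal alpha).
have sAS : Tkernel F alpha \subset Sgroup F alpha := patternS _ (hookk_source alpha).
have sSU : Sgroup F alpha \subset UY F Y n := patternS _ (subsetT _).
have nKU : pattern_group F (kset alpha) <| UY F Y n :=
  pattern_normal xP (kset_normal alpha).
have sKA : pattern_group F (kset alpha) \subset Tkernel F alpha :=
  patternS _ (subsetUr _ _).
have sKM : pattern_group F (kset alpha) \subset Skernel F alpha.
  apply: (patternS (@root_elt F Y n)); apply/subsetP=> g gk.
  rewrite in_setD1 kset_source // andbT.
  by apply: contraTneq gk => ->; apply: notin_kset.
have sXA : root_subgroup F alpha \subset Tkernel F alpha.
  by apply: (rootg_pattern (@root_elt F Y n)); rewrite -setUA setU11.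
have abX : abelian (root_subgroup F alpha) := rootg_abelian xP alpha.
have cXU : ([~: root_subgroup F alpha, UY F Y n] \subset pattern_group F (kset alpha))%g :=
  root_central xP alpha.
have sLM : pattern_group F (leg alpha :|: kset alpha) \subset Skernel F alpha.
  apply: (patternS (@root_elt F Y n)); apply/subsetP=> g gL.
  have [sLS _] := normal_patternP _ _ (legk_normal alpha).
  rewrite in_setD1 (subsetP sLS) // andbT; case/setUP: gL => [/legP[b _]|gk].
    by case/rsum_neq/andP.
  by apply: contraTneq gk => ->; apply: notin_kset.
have IS lambda : lambda \in irr (root_subgroup F alpha) -> lambda != 1%R ->
    'I_(UY F Y n)[('Res[Tkernel F alpha] (cfSdprod sdS lambda))%R]%g = Sgroup F alpha.
  move=> lirr l1; have Lth : cfSdprod sdS lambda \is a linear_char.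
    by rewrite cfSdprod_lin_char; case/irrP: lirr => i ->; apply: char_abelianP.
  apply: (inertia_source xP (cfRes_lin_char _ Lth)) => [y yL|].
    have yT : y \in Tkernel F alpha := subsetP (patternS _ (legk_hookk alpha)) _ yL.
    rewrite cfResE // cfker1 ?(lin_char1 Lth) //.
    by apply: subsetP (cfker_sdprod _ _) _ _; apply: subsetP sLM _ yL.
  apply: contra l1 => /forallP l0; apply/eqP/cfun_inP=> y yX; rewrite cfun1E yX.
  have /rootgP[t Et] := yX; have /eqP := l0 t.
  by rewrite -Et cfResE ?(subsetP sXA) // cfSdprodEr.
have idx : (#|Tkernel F alpha : pattern_group F (kset alpha) <*> root_subgroup F alpha|
    <= #|UY F Y n : Sgroup F alpha|)%N.
  by rewrite (eq_leq (arm_leg_index xP alpha)).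
have := arm_leg_correspondence nAU sAS sSU nKU sKA sKM sXA abX cXU IS idx.
apply: eq_bijection_on => // [chi | ml].
  rewrite !inE; case chiirr: (chi \in irr _) => //=.
  by have := irr_rootP xP alpha chiirr => ->.
by rewrite /Psi inflE.
Qed.

Theorem theorem1p1 (Y : dynkin) (n : nat) (p e : nat) (F : finFieldType)
    (rankP : rank_ok Y n) (p_prime : prime p) (cardF : #|F| = (p ^ e)%N)
    (p_odd : Y = TypeB \/ Y = TypeC -> (2 < p)%N) (alpha : posroot Y n) :
  [/\ is_arm_leg alpha (arm alpha) (leg alpha),
      closed_pattern (source alpha),
      normal_pattern (leg alpha :&: kset alpha) (source alpha),
      normal_pattern (leg alpha :|: kset alpha) (source alpha)
    & bijection_on (@irr_domain F Y n alpha) (@irr_root F Y n alpha)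
        (@Psi F Y n alpha)].
Proof.
split; first exact: arm_is_arm_leg.
- exact: source_closed.
- rewrite leg_cap_kset; apply/normal_patternP; split; first exact: sub0set.
  by move=> b g d; rewrite inE.
- exact: legk_normal.
by apply: Psi_bijection => /p_odd; apply: two_neq0_of_card cardF.
Qed.
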